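(* Let $\Phi$ be an aperiodic graphing on a standard probability space $(X,\mu)$. Then the closure $\overline{D([\Phi]_1)}$ in $[\Phi]_1$ of the derived group of $[\Phi]_1$ is connected.
   Context: A standard probability space $(X,\mu)$ is a standard Borel space with a non-atomic Borel probability measure; everything is up to null sets. $\mathrm{Aut}(X,\mu)$ is the group of measure-preserving Borel bijections of $X$ modulo a.e. equality. A partial isomorphism is a measure-preserving Borel bijection $\varphi:\mathrm{dom}\,\varphi\to\mathrm{rng}\,\varphi$ between Borel subsets of $X$. A graphing $\Phi$ is a countable set of partial isomorphisms; it generates the equivalence relation $\mathcal R_\Phi$, the smallest one containing all $(x,\varphi(x))$ with $\varphi\in\Phi$, $x\in\mathrm{dom}\,\varphi$. $\Phi$ is aperiodic if almost every $\mathcal R_\Phi$-class is infinite. On $\mathcal R_\Phi$-classes put $d_\Phi(x,y)=\min\{n:\exists\varphi_1,\dots,\varphi_n\in\Phi\cup\Phi^{-1},\ y=\varphi_n\cdots\varphi_1(x)\}$. The full group is $[\mathcal R_\Phi]=\{T\in\mathrm{Aut}(X,\mu):(x,T(x))\in\mathcal R_\Phi\text{ a.e.}\}$ and the $\mathrm L^1$ full group is $[\Phi]_1=\{T\in[\mathcal R_\Phi]:\int_Xd_\Phi(x,T(x))\,d\mu<+\infty\}$, with the topology induced by the metric $\tilde d_\Phi(S,T)=\int_Xd_\Phi(S(x),T(x))\,d\mu(x)$. $D(G)$ denotes the derived subgroup of $G$. *)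

(* Defs.v *)
From HB Require Import structures.
From mathcomp Require Import all_boot all_order all_algebra generic_quotient.
From mathcomp Require Import all_classical all_reals all_analysis.

Set Implicit Arguments.
Unset Strict Implicit.
Unset Printing Implicit Defensive.

Import Order.TTheory GRing.Theory Num.Theory.
Import numFieldNormedType.Exports.

Local Open Scope classical_set_scope.
Local Open Scope ring_scope.

(* Hausdorff, complete pseudometric and second countable means Polish; the last
   clause says that [f] carries the measurable sets onto the Borel sets. *)
Definition standard_borel (R : realType) d (T : measurableType d) : Prop :=
  exists (P : completePseudoMetricType R) (f : T -> P),
    [/\ hausdorff_space P, @second_countable P, bijective f &
        forall A : set T, measurable A <-> <<s @open P >> (f @` A)].

Definition nonatomic (R : realType) d (T : measurableType d)
    (mu : {measure set T -> \bar R}) : Prop :=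
  forall A, measurable A -> (0 < mu A)%E ->
    exists B, [/\ measurable B, B `<=` A, (0 < mu B)%E & (mu B < mu A)%E].

Definition derived_subgroup (G : groupType) (H : set G) : set G :=
  smallest (fun K : set G => group_closed (mem K))
           [set commg x y | x in H & y in H].

(* On a standard Borel space the measurability of the inverse is automatic
   (Lusin-Souslin); it is a field so that these maps form a group over an
   arbitrary measurable space.  The same remark applies to
   [measurable_pi_image] in [partial_iso] below. *)
Record mp_bij d (T : measurableType d) (R : realType) (mu : probability T R) :=
  MpBij {
    mp_fun :> T -> T;
    mp_inv : T -> T;
    mp_funK : cancel mp_fun mp_inv;
    mp_invK : cancel mp_inv mp_fun;
    measurable_mp_fun : measurable_fun setT mp_fun;
    measurable_mp_inv : measurable_fun setT mp_inv;
    mp_fun_preserving :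
      forall A, measurable A -> mu (mp_fun @^-1` A) = mu A
  }.

Section automorphism_group.
Context d (T : measurableType d) (R : realType) (mu : probability T R).

HB.instance Definition _ := gen_eqMixin (mp_bij mu).
HB.instance Definition _ := gen_choiceMixin (mp_bij mu).

Definition mp_ae_eq (S U : mp_bij mu) : bool :=
  `[< (S : T -> T) = U %[ae mu] >].

Let mp_ae_eq_refl : reflexive mp_ae_eq.
Proof. by move=> S; apply/asboolP; exact: aeW. Qed.

Let mp_ae_eq_sym : symmetric mp_ae_eq.
Proof.
by move=> S U; apply/idP/idP => /asboolP h; apply/asboolP;
  apply: filterS h => x /(_ I) h _; rewrite h.
Qed.

Let mp_ae_eq_trans : transitive mp_ae_eq.
Proof.
move=> S U V /asboolP US /asboolP SV; apply/asboolP.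
by apply: filterS2 US SV => x /(_ I) -> /(_ I) -> _.
Qed.

Canonical mp_ae_eq_equiv :=
  EquivRel mp_ae_eq mp_ae_eq_refl mp_ae_eq_sym mp_ae_eq_trans.

Local Open Scope quotient_scope.

(* Aut(X, mu): measure-preserving bijections modulo a.e. equality *)
Definition aut : Type := {eq_quot mp_ae_eq}.
HB.instance Definition _ := Choice.on aut.
HB.instance Definition _ := EqQuotient.on aut.

Definition aut_fun (S : aut) : T -> T := repr S.
Coercion aut_fun : aut >-> Funclass.

Lemma mp_one_preserving A : measurable A -> mu (id @^-1` A) = mu A.
Proof. by []. Qed.

Definition mp_one : mp_bij mu :=
  MpBij (fun=> erefl) (fun=> erefl) (@measurable_id _ _ setT) (@measurable_id _ _ setT)
        mp_one_preserving.

Lemma mp_comp_preserving (S U : mp_bij mu) A :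
  measurable A -> mu ((S \o U) @^-1` A) = mu A.
Proof.
move=> mA; rewrite comp_preimage mp_fun_preserving ?mp_fun_preserving//.
by rewrite -[X in measurable X]setTI; exact: measurable_mp_fun.
Qed.

Definition mp_comp (S U : mp_bij mu) : mp_bij mu :=
  MpBij (can_comp (@mp_funK _ _ _ _ S) (@mp_funK _ _ _ _ U))
        (can_comp (@mp_invK _ _ _ _ U) (@mp_invK _ _ _ _ S))
        (measurableT_comp (measurable_mp_fun S) (measurable_mp_fun U))
        (measurableT_comp (measurable_mp_inv U) (measurable_mp_inv S))
        (@mp_comp_preserving S U).

Lemma mp_inv_preserving (S : mp_bij mu) A :
  measurable A -> mu (mp_inv S @^-1` A) = mu A.
Proof.
move=> mA; rewrite -(mp_fun_preserving S).
  by congr (mu _); apply/seteqP; split=> x /=; rewrite mp_funK.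
by rewrite -[X in measurable X]setTI; exact: measurable_mp_inv.
Qed.

Definition mp_inverse (S : mp_bij mu) : mp_bij mu :=
  MpBij (@mp_invK _ _ _ _ S) (@mp_funK _ _ _ _ S)
        (measurable_mp_inv S) (measurable_mp_fun S) (@mp_inv_preserving S).

Lemma ae_mp_fun (S : mp_bij mu) (P : T -> Prop) :
  (\forall x \ae mu, P x) -> \forall x \ae mu, P (S x).
Proof.
move=> [N [mN N0 PN]]; have mSN : measurable (S @^-1` N).
  by rewrite -[X in measurable X]setTI; exact: measurable_mp_fun.
exists (S @^-1` N); split=> //; first by rewrite mp_fun_preserving.
by move=> x /= nPx; exact: PN.
Qed.

Lemma mp_eqP (S U : mp_bij mu) :
  reflect (\pi_aut S = \pi_aut U) (mp_ae_eq S U).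
Proof. by apply: (iffP idP) => [/eqmodP|/eqmodP]. Qed.

Lemma mp_reprP (S : mp_bij mu) :
  \forall x \ae mu, repr (\pi_aut S) x = S x.
Proof.
have /mp_eqP/asboolP : \pi_aut (repr (\pi_aut S)) = \pi_aut S by rewrite reprK.
by apply: filterS => x; apply.
Qed.

Definition aut_one : aut := \pi_aut mp_one.
(* The product is composition: (S * U) x = S (U x). *)
Definition aut_mul (S U : aut) : aut := \pi_aut (mp_comp (repr S) (repr U)).
Definition aut_inv (S : aut) : aut := \pi_aut (mp_inverse (repr S)).

Lemma aut_mul_pi (S U : mp_bij mu) :
  aut_mul (\pi_aut S) (\pi_aut U) = \pi_aut (mp_comp S U).
Proof.
apply/mp_eqP/asboolP.
apply: filterS2 (ae_mp_fun (repr (\pi_aut U)) (mp_reprP S)) (mp_reprP U).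
by move=> x h1 h2 _ /=; rewrite h1 h2.
Qed.

Lemma aut_inv_pi (S : mp_bij mu) : aut_inv (\pi_aut S) = \pi_aut (mp_inverse S).
Proof.
apply/mp_eqP/asboolP.
apply: filterS (ae_mp_fun (mp_inverse S) (mp_reprP S)) => x /= h _.
by rewrite -[in LHS](mp_invK S x) -h mp_funK.
Qed.

Lemma mp_bij_eq (S U : mp_bij mu) :
  (forall x, S x = U x) -> \pi_aut S = \pi_aut U.
Proof. by move=> SU; apply/mp_eqP/asboolP; apply: aeW => x _; exact: SU. Qed.

Lemma aut_mulA : associative aut_mul.
Proof.
elim/quotW=> S; elim/quotW=> U; elim/quotW=> V.
rewrite (aut_mul_pi U V) (aut_mul_pi S U) (aut_mul_pi S (mp_comp U V)).
rewrite (aut_mul_pi (mp_comp S U) V).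
by apply: mp_bij_eq.
Qed.

Lemma aut_mul1 : left_id aut_one aut_mul.
Proof. by elim/quotW=> S; rewrite aut_mul_pi; apply: mp_bij_eq. Qed.

Lemma aut_mulr1 : right_id aut_one aut_mul.
Proof. by elim/quotW=> S; rewrite aut_mul_pi; apply: mp_bij_eq. Qed.

Lemma aut_mulV : left_inverse aut_one aut_inv aut_mul.
Proof.
elim/quotW=> S; rewrite aut_inv_pi aut_mul_pi; apply: mp_bij_eq => x /=.
exact: mp_funK.
Qed.

Lemma aut_mulrV : right_inverse aut_one aut_inv aut_mul.
Proof.
elim/quotW=> S; rewrite aut_inv_pi aut_mul_pi; apply: mp_bij_eq => x /=.
exact: mp_invK.
Qed.

HB.instance Definition _ :=
  isGroup.Build aut aut_mulA aut_mul1 aut_mulr1 aut_mulV aut_mulrV.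

End automorphism_group.

(* The values of [pi_fun] outside [pi_dom] are irrelevant. *)
Record partial_iso d (T : measurableType d) (R : realType)
    (mu : probability T R) := PartialIso {
  pi_dom : set T;
  pi_rng : set T;
  pi_fun :> T -> T;
  measurable_pi_dom : measurable pi_dom;
  measurable_pi_rng : measurable pi_rng;
  pi_fun_bij : set_bij pi_dom pi_rng pi_fun;
  measurable_pi_fun : measurable_fun pi_dom pi_fun;
  measurable_pi_image :
    forall A, measurable A -> A `<=` pi_dom -> measurable (pi_fun @` A);
  pi_fun_preserving :
    forall A, measurable A -> A `<=` pi_dom -> mu (pi_fun @` A) = mu A
}.

Section graphings.
Context d (T : measurableType d) (R : realType) (mu : probability T R).
Implicit Types Phi : set (partial_iso mu).

Definition is_graphing Phi : Prop := countable Phi.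

Definition graphing_rel Phi (x y : T) : Prop :=
  forall E : T -> T -> Prop, RelationClasses.Equivalence E ->
    (forall phi z, Phi phi -> pi_dom phi z -> E z (phi z)) -> E x y.

Definition aperiodic Phi : Prop :=
  \forall x \ae mu, infinite_set [set y | graphing_rel Phi x y].

(* y = psi x for some psi in Phi or Phi^-1 *)
Definition graphing_step Phi (x y : T) : Prop :=
  exists2 phi, Phi phi &
    (pi_dom phi x /\ y = phi x) \/ (pi_dom phi y /\ x = phi y).

Fixpoint graphing_path Phi (n : nat) (x y : T) : Prop :=
  if n is m.+1 then exists2 z, graphing_path Phi m x z & graphing_step Phi z y
  else y = x.

(* +oo when x and y are not equivalent *)
Definition graphing_dist Phi (x y : T) : \bar R :=
  ereal_inf [set n%:R%:E | n in [set n | graphing_path Phi n x y]].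

Definition full_group Phi : set (aut mu) :=
  [set S | \forall x \ae mu, graphing_rel Phi x (S x)].

Definition L1_full_group Phi : set (aut mu) :=
  [set S | full_group Phi S /\
           (\int[mu]_x graphing_dist Phi x (S x) < +oo)%E].

Definition L1_dist Phi (S U : aut mu) : \bar R :=
  (\int[mu]_x graphing_dist Phi (S x) (U x))%E.

Definition L1_full Phi : Type := set_type (L1_full_group Phi).

End graphings.

Section L1_topology.
Context d (T : measurableType d) (R : realType) (mu : probability T R).
Variable Phi : set (partial_iso mu).

HB.instance Definition _ := Choice.on (L1_full Phi).

Definition L1_ball (S : L1_full Phi) (e : R) : set (L1_full Phi) :=
  [set U | (L1_dist Phi (sval S) (sval U) < e%:E)%E].

(* The metric topology: a set is open when it contains an [L1_dist]-ball around
   each of its points. *)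
Definition L1_open (O : set (L1_full Phi)) : Prop :=
  forall S, O S -> exists2 e : R, 0 < e & L1_ball S e `<=` O.

Let L1_openT : L1_open setT.
Proof. by move=> S _; exists 1. Qed.

Let L1_openI : setI_closed L1_open.
Proof.
move=> A B oA oB S [/oA[e e0 eA] /oB[f f0 fB]].
exists (Order.min e f); first by rewrite lt_min e0 f0.
by move=> U; rewrite /L1_ball /= EFin_min lt_min => /andP[? ?];
  split; [exact: eA|exact: fB].
Qed.

Let L1_open_bigU (I : Type) (f : I -> set (L1_full Phi)) :
  (forall i, L1_open (f i)) -> L1_open (\bigcup_i f i).
Proof.
move=> of_ S [i _ /of_[e e0 ef]]; exists e => // U /ef fU.
by exists i.
Qed.

HB.instance Definition _ :=
  isOpenTopological.Build (L1_full Phi) L1_openT L1_openI L1_open_bigU.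

(* The subgroup generated by the commutators of [Phi]_1 is computed in the
   ambient group Aut(X, mu) and seen as a subset of [Phi]_1. *)
Definition derived_L1_full : set (L1_full Phi) :=
  [set S : L1_full Phi | derived_subgroup (L1_full_group Phi) (sval S)].

End L1_topology.

Arguments derived_L1_full {d T R mu} Phi.

(* Main.v *)
Require Import Defs.
From HB Require Import structures.
From mathcomp Require Import all_boot all_order all_algebra.
From mathcomp Require Import all_classical all_reals all_analysis.
From mathcomp Require Import measurable_realfun generic_quotient lra.

Set Implicit Arguments.
Unset Strict Implicit.
Unset Printing Implicit Defensive.

Import Order.TTheory GRing.Theory Num.Theory.
Import numFieldNormedType.Exports.

Local Open Scope classical_set_scope.
Local Open Scope ring_scope.

(** Write G for the L1 full group of [Phi] and E for the subgroup generated by the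
    involutions of G.  The closures of E and of the derived group of G coincide,
    and E is connected; so is its closure.

    All constructions use a bounded measurable injection [f] of the space into the
    reals ([standard_borel_real_coordinate]).  It orders the points, its rational
    level sets separate them, and its level sets are null because the measure has
    no atoms.

    Derived group inside the closure of E ([commutator_in_closure]).  Let A be a
    set meeting the orbit of almost every point moved by S.  Composing S with the
    involutions that exchange the points of A with their images under the powers
    of S removes the points off A from the support of S one after the other; the
    process converges in G to the first-return map of S to A, which therefore
    agrees with S modulo the closure of E ([first_return_map]).  By recurrence the
    sets A1, where S increases [f], and A2, where S decreases [f], both qualify.
    Given U in G, its restriction to the U-orbits that leave A1 agrees likewise with
    a map supported off A1, which commutes with the first-return map of S to A1; the
    rest of U is supported in A1, so that it commutes with the first-return map of S
    to A2.  Hence S and U commute modulo the closure of E, which is a normal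
    subgroup.

    E inside the closure of the derived group ([involution_in_closure]).  Let t be
    an involution of G and A the set where t increases [f], a fundamental domain of
    t.  As [Phi] is aperiodic, a greedy construction exhausts A up to a null set by
    pairs of disjoint sets C and g C, where g moves points by a bounded distance
    inside their classes.  On C, g C and their images under t, the involution t
    is a product of two involutions conjugate in G, hence a commutator.  Finitely
    many of these pieces already approximate t.

    E is connected ([involutive_products_connected]): an involution V is joined to
    the identity by its restrictions to the sets of points x at which the smaller of
    [f x] and [f (V x)] is at most r, which vary continuously with r since level
    sets of [f] are null.

    Representatives of automorphisms are handled as actual bijections, so that
    identities between products hold at every point; almost everywhere equality only
    enters at the end, when passing to the quotient. *)

(** * A linear coordinate on the space *)

Lemma countable_range_sub (V : Type) (v0 : V) (A : set V) : countable A ->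
  exists e : nat -> V, (forall v, A v -> exists n, e n = v) /\
                       (forall n, e n = v0 \/ A (e n)).
Proof.
move=> /countable_injP[g ginj].
exists (fun n => if pselect (exists v, A v /\ g v = n) is left h
                  then projT1 (cid h) else v0).
split => [v Av|n]; last by case: pselect => [h|_]; [right; case: cid => ? []|left].
exists (g v); case: pselect => [h|[]]; last by exists v.
by case: cid => u [Au gu] /=; apply: ginj => //; rewrite inE.
Qed.

(** A countable basis of the underlying Polish space separates its points. *)
Lemma standard_borel_separating (R : realType) d (T : measurableType d) :
  standard_borel R T ->
  exists B : nat -> set T, (forall n, measurable (B n)) /\
    forall x y, x <> y -> exists n, B n x /\ ~ B n y.
Proof.
move=> [P [f [hP [B cB [Bop Bb]] fbij fm]]].
have [e [eB Be]] := countable_range_sub set0 cB.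
have finj : injective f by exact: bij_inj.
have fsurj y : exists x, f x = y by case: fbij => g fK gK; exists (g y).
exists (fun n => f @^-1` e n); split => [n|x y xy].
  apply/fm; rewrite image_preimage; last first.
    by apply/seteqP; split=> y // _; have [x <-] := fsurj y; exists x.
  apply: sub_sigma_algebra => /=.
  by case: (Be n) => [->|/Bop//]; exact: open0.
have /(hausdorff_accessible hP)[A [oA /set_mem Ax /set_mem Ay]] : f x != f y.
  by apply/eqP => /finj.
have [U /= [BU Ux] UA] := Bb (f x) A (open_nbhs_nbhs (conj oA Ax)).
by have [n en] := eB _ BU; exists n; rewrite en; split=> // /UA.
Qed.

Section ternary.
Context (R : realType) d (T : measurableType d).
Variable B : nat -> set T.
Hypothesis mB : forall n, measurable (B n).
Hypothesis Bsep : forall x y, x <> y -> exists n, B n x /\ ~ B n y.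

Let s n (x : T) : R := \sum_(i < n) 3^-1 ^+ i * \1_(B i) x.

Let s_nd x : nondecreasing_seq (s^~ x).
Proof. by apply/nondecreasing_seqP => n; rewrite /s big_ord_recr/= lerDl. Qed.

Let s_ub i n x : s (i + n) x <= s i x + 3 / 2 * 3^-1 ^+ i * (1 - 3^-1 ^+ n).
Proof.
elim: n => [|n IH]; first by rewrite addn0 expr0 subrr mulr0 addr0.
rewrite addnS {1}/s big_ord_recr/= -/(s _ _).
have : 3^-1 ^+ (i + n) * \1_(B (i + n)) x <= (3^-1 ^+ i * 3^-1 ^+ n : R).
  by rewrite exprD ler_piMr// ?mulr_ge0 ?exprn_ge0//.
rewrite [3^-1 ^+ n.+1]exprS.
move: IH; set a := 3^-1 ^+ i; set b := 3^-1 ^+ n => IH h.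
by nra.
Qed.

Let s_ub' i n x : s n x <= s i x + 3 / 2 * 3^-1 ^+ i.
Proof.
apply: (@le_trans _ _ (s (i + n) x)); first by apply: s_nd; rewrite leq_addl.
by apply: le_trans (s_ub i n x) _; rewrite lerD2l ler_piMr// gerDl oppr_le0.
Qed.

Let s_bnd x : has_ubound (range (s^~ x)).
Proof. by exists (s 0%N x + 3 / 2 * 3^-1 ^+ 0) => _ [n _ <-]. Qed.

Let f x : R := sup (range (s^~ x)).

Let s_f n x : s n x <= f x.
Proof. by apply: ub_le_sup; [exact: s_bnd|exists n]. Qed.

Let f_s i x : f x <= s i x + 3 / 2 * 3^-1 ^+ i.
Proof. by apply: ge_sup => [|_ [n _ <-]//]; exists (s 0%N x), 0%N. Qed.

Let f_inj : injective f.
Proof.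
move=> x y fxy; apply: contrapT => xy.
have neq : exists n, \1_(B n) x != \1_(B n) y :> R.
  have [n [Bx By]] := Bsep xy; exists n.
  by rewrite !indicE (mem_set Bx) (memNset By) oner_neq0.
have [n [nxy nmin]] : exists n,
    \1_(B n) x != \1_(B n) y :> R /\ s n x = s n y.
  case: (ex_minnP neq) => m mxy mmin; exists m; split => //.
  apply: eq_bigr => i _; congr (_ * _); apply/eqP/negPn/negP => /mmin.
  by rewrite leqNgt ltn_ord.
have key a b : s n a = s n b -> B n a -> ~ B n b -> f b < f a.
  move=> sab Ba Bb; apply: le_lt_trans (f_s n.+1 b) _.
  apply: lt_le_trans (s_f n.+1 a).
  rewrite /s !big_ord_recr/= -!/(s _ _) sab !indicE (mem_set Ba) (memNset Bb).
  rewrite mulr0 addr0 mulr1 ltrD2l exprS.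
  have : (0 : R) < 3^-1 ^+ n by rewrite exprn_gt0.
  by set a' := _ ^+ n => ?; nra.
have [Bx|Bx] := pselect (B n x); have [By|By] := pselect (B n y).
- by move: nxy; rewrite !indicE (mem_set Bx) (mem_set By) eqxx.
- by have := key _ _ nmin Bx By; rewrite fxy ltxx.
- by have := key _ _ (esym nmin) By Bx; rewrite fxy ltxx.
- by move: nxy; rewrite !indicE (memNset Bx) (memNset By) eqxx.
Qed.

(** The ternary expansions whose digits are the values at a point of the
    indicators of a separating sequence determine the point, because a digit
    outweighs the sum of all later ones. *)
Lemma separating_measurable_injection :
  exists g : T -> R,
    [/\ measurable_fun setT g, injective g & forall x, 0 <= g x <= 2].
Proof.
exists f; split => //.
  apply: (@measurable_fun_cvg _ _ _ _ s) => [n|x _].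
    apply: measurable_sum => i.
    by apply: measurable_funM => //; exact: measurable_indic.
  exact: nondecreasing_cvgn.
move=> x; have := s_f 0 x; have := f_s 0 x.
by rewrite /s big_ord0 expr0 => h ->; apply: le_trans h _; lra.
Qed.

End ternary.

Lemma standard_borel_real_coordinate (R : realType) d (T : measurableType d) :
  standard_borel R T ->
  exists g : T -> R,
    [/\ measurable_fun setT g, injective g & forall x, 0 <= g x <= 2].
Proof.
by move=> /standard_borel_separating[B [mB]]; exact: separating_measurable_injection.
Qed.

(** * Measure-preserving bijections as a group *)

(** The group structure lives on the bijections themselves rather than on their
    classes modulo null sets: equality of products can then be checked at each point. *)
Section mp_bij_group.
Context d (T : measurableType d) (R : realType) (mu : probability T R).
Implicit Types (S U : mp_bij mu) (A Y : set T).

Lemma mp_bij_ext S U : (forall x, S x = U x) -> S = U.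
Proof.
move=> /funext; case: S => f f' fK f'K mf mf' pf; case: U => g g' gK g'K mg mg' pg.
move=> /= fg; subst g; have fg' : f' = g' by apply/funext => x; rewrite -[in LHS](g'K x) fK.
subst g'; congr MpBij; exact: Prop_irrelevance.
Qed.

Let mp_mulA : associative (@mp_comp _ _ _ mu).
Proof. by move=> S U V; exact: mp_bij_ext. Qed.
Let mp_mul1 : left_id (mp_one mu) (@mp_comp _ _ _ mu).
Proof. by move=> S; exact: mp_bij_ext. Qed.
Let mp_mulr1 : right_id (mp_one mu) (@mp_comp _ _ _ mu).
Proof. by move=> S; exact: mp_bij_ext. Qed.
Let mp_mulV : left_inverse (mp_one mu) (@mp_inverse _ _ _ mu) (@mp_comp _ _ _ mu).
Proof. by move=> S; apply: mp_bij_ext => x; exact: mp_funK. Qed.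
Let mp_mulrV : right_inverse (mp_one mu) (@mp_inverse _ _ _ mu) (@mp_comp _ _ _ mu).
Proof. by move=> S; apply: mp_bij_ext => x; exact: mp_invK. Qed.

HB.instance Definition _ :=
  isGroup.Build (mp_bij mu) mp_mulA mp_mul1 mp_mulr1 mp_mulV mp_mulrV.

Lemma mpME S U x : (S * U)%g x = S (U x). Proof. by []. Qed.

Lemma mp1E x : (1%g : mp_bij mu) x = x. Proof. by []. Qed.

Lemma mpK S : cancel S (S^-1)%g. Proof. exact: mp_funK. Qed.

Lemma mpVK S : cancel (S^-1)%g S. Proof. exact: mp_invK. Qed.

Lemma mp_inj S : injective S. Proof. exact: can_inj (mpK S). Qed.

Lemma mpXS S n x : (S ^+ n.+1)%g x = S ((S ^+ n)%g x).
Proof. by rewrite expgS. Qed.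

Lemma mpXSr S n x : (S ^+ n.+1)%g x = (S ^+ n)%g (S x).
Proof. by rewrite expgSr. Qed.

Lemma mpXD S m n x : (S ^+ (m + n))%g x = (S ^+ m)%g ((S ^+ n)%g x).
Proof. by rewrite expgnDr. Qed.

Lemma mpXK S n : cancel (S ^+ n)%g (S^-1 ^+ n)%g.
Proof. by rewrite expVgn; exact: mpK. Qed.

Lemma mpXVK S n : cancel (S^-1 ^+ n)%g (S ^+ n)%g.
Proof. by rewrite expVgn; exact: mpVK. Qed.

Lemma measurable_mp S : measurable_fun setT S.
Proof. exact: measurable_mp_fun. Qed.

Lemma measurable_mp_preimage S A : measurable A -> measurable (S @^-1` A).
Proof. by move=> mA; rewrite -[X in measurable X]setTI; exact: measurable_mp. Qed.

Lemma mp_preimage S A : measurable A -> mu (S @^-1` A) = mu A.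
Proof. exact: mp_fun_preserving. Qed.

Lemma mp_image S A : S @` A = (S^-1)%g @^-1` A.
Proof.
apply/seteqP; split=> [_ [x Ax <-]|x Ax]; first by rewrite /= mp_funK.
by exists ((S^-1)%g x) => //; exact: mpVK.
Qed.

Lemma mp_integral_preimage S A (F : T -> \bar R) : measurable A ->
  measurable_fun setT F -> (forall x, 0 <= F x)%E ->
  (\int[mu]_(x in S @^-1` A) F (S x) = \int[mu]_(x in A) F x)%E.
Proof.
move=> mA mF F0.
have := @ge0_integral_pushforward _ _ _ _ R S (measurable_mp S) mu A F mA
  (measurable_funS measurableT (@subsetT _ _) mF) (fun y _ => F0 y).
move=> <-; apply: eq_measure_integral; [exact: measurable_mp|move=> mS B mB _].
by rewrite /= /pushforward -(mp_preimage S mB).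
Qed.

Lemma mp_integral S (F : T -> \bar R) :
  measurable_fun setT F -> (forall x, 0 <= F x)%E ->
  (\int[mu]_x F (S x) = \int[mu]_x F x)%E.
Proof. by move=> mF F0; rewrite -(mp_integral_preimage S measurableT mF F0). Qed.

Lemma mp_negligible S A : mu.-negligible A -> mu.-negligible (S @^-1` A).
Proof.
move=> [N [mN N0 AN]]; exists (S @^-1` N); split; last exact: preimage_subset.
  exact: measurable_mp_preimage.
by rewrite mp_preimage.
Qed.

Lemma probability_setU A B : measurable A -> measurable B -> A `&` B = set0 ->
  mu (A `|` B) = (mu A + mu B)%E.
Proof. by move=> mA mB AB; rewrite measureU. Qed.

Section restriction.
Variables (S : mp_bij mu) (Y : set T).
Hypotheses (mY : measurable Y) (SY : forall x, Y (S x) <-> Y x).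

Let f x := if pselect (Y x) then S x else x.
Let f' x := if pselect (Y x) then (S^-1)%g x else x.

Let SVY x : Y ((S^-1)%g x) <-> Y x.
Proof. by rewrite -SY mpVK. Qed.

Let preim U (g := fun x => if pselect (Y x) then U x else x) A :
  g @^-1` A = (Y `&` U @^-1` A) `|` (~` Y `&` A).
Proof.
apply/seteqP; split=> x; rewrite /g /=; first by case: pselect => ? ?; [left|right].
by move=> [][? ?]; case: pselect.
Qed.

Let mrestr (U : mp_bij mu) : measurable_fun setT (fun x => if pselect (Y x) then U x else x).
Proof.
move=> _ A mA; rewrite setTI preim; apply: measurableU; apply: measurableI => //.
  exact: measurable_mp_preimage.
exact: measurableC.
Qed.

Let frestrK : cancel f f'.
Proof.
move=> x; rewrite /f /f'; case: (pselect (Y x)) => Yx; case: pselect => // Yy.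
  exact: mpK.
by case: Yy; apply/SY.
Qed.

Let frestrVK : cancel f' f.
Proof.
move=> x; rewrite /f /f'; case: (pselect (Y x)) => Yx; case: pselect => // Yy.
  exact: mpVK.
by case: Yy; apply/SVY.
Qed.

Let frestr_preserving A : measurable A -> mu (f @^-1` A) = mu A.
Proof.
move=> mA; rewrite preim (_ : Y `&` _ = S @^-1` (Y `&` A)); last first.
  by apply/seteqP; split=> x [? ?]; split => //; apply/SY.
rewrite probability_setU//.
- rewrite mp_preimage; last exact: measurableI.
  rewrite -probability_setU; [|exact: measurableI|apply: measurableI => //; exact: measurableC|].
    by rewrite -setIUl setUv setTI.
  by rewrite setIACA setICr set0I.
- by apply: measurable_mp_preimage; exact: measurableI.
- by apply: measurableI => //; exact: measurableC.
- by apply/seteqP; split => // x [[/= /SY ? _] []].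
Qed.

Definition mp_restr : mp_bij mu :=
  MpBij frestrK frestrVK (mrestr S) (mrestr S^-1%g) frestr_preserving.

Lemma mp_restr_in x : Y x -> mp_restr x = S x.
Proof. by rewrite /= /f; case: pselect. Qed.

Lemma mp_restr_out x : ~ Y x -> mp_restr x = x.
Proof. by rewrite /= /f; case: pselect. Qed.

Lemma mp_restrV_in x : Y x -> (mp_restr^-1)%g x = (S^-1)%g x.
Proof. by rewrite /= /f'; case: pselect. Qed.

Lemma mp_restrX_in n x : Y x -> (mp_restr ^+ n)%g x = (S ^+ n)%g x.
Proof.
by elim: n x => // n IH x Yx; rewrite !mpXSr mp_restr_in// IH//; apply/SY.
Qed.

Lemma mp_restrXV_in n x : Y x -> (mp_restr^-1 ^+ n)%g x = (S^-1 ^+ n)%g x.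
Proof.
by elim: n x => // n IH x Yx; rewrite !mpXSr mp_restrV_in// IH//; apply/SVY.
Qed.

End restriction.

Section swap.
Variable phi : partial_iso mu.
Hypothesis disj : forall x, pi_dom phi x -> pi_rng phi x -> False.

Let D := pi_dom phi.
Let Rg := pi_rng phi.

Let q y : T := if pselect (exists x, D x /\ phi x = y) is left h
               then projT1 (cid h) else y.

Let pD x : D x -> Rg (phi x).
Proof. by case: (pi_fun_bij phi) => h _ _; exact: h. Qed.

Let qK x : D x -> q (phi x) = x.
Proof.
move=> Dx; rewrite /q; case: pselect => [h|[]]; last by exists x.
case: cid => y [Dy yx] /=.
by case: (pi_fun_bij phi) => _ inj _; apply: inj => //; rewrite inE.
Qed.

Let qR y : Rg y -> D (q y) /\ phi (q y) = y.
Proof.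
move=> Ry; case: (pi_fun_bij phi) => _ _ /(_ y Ry)[x Dx <-].
by rewrite qK.
Qed.

Let f x := if pselect (D x) then phi x else if pselect (Rg x) then q x else x.

Let fD x : D x -> f x = phi x.
Proof. by rewrite /f; case: pselect. Qed.

Let fR x : Rg x -> f x = q x.
Proof.
rewrite /f => Rx; case: pselect => Dx; first by have := disj Dx Rx.
by case: pselect.
Qed.

Let fO x : ~ D x -> ~ Rg x -> f x = x.
Proof. by rewrite /f => ? ?; case: pselect => // ?; case: pselect. Qed.

Let fK : involutive f.
Proof.
move=> x; have [Dx|Dx] := pselect (D x).
  by rewrite (fD Dx) fR ?qK//; exact: pD.
have [Rx|Rx] := pselect (Rg x); last by rewrite !fO.
by rewrite (fR Rx); have [Dq pq] := qR Rx; rewrite fD.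
Qed.

Let pre A : f @^-1` A =
  (D `&` phi @^-1` A) `|` (phi @` (A `&` D) `|` (A `&` ~` (D `|` Rg))).
Proof.
apply/seteqP; split=> x /=.
  have [Dx|Dx] := pselect (D x); first by rewrite fD// => ?; left.
  have [Rx|Rx] := pselect (Rg x).
    by rewrite fR// => Aq; right; left; exists (q x); have [] := qR Rx.
  by rewrite fO// => Ax; right; right; split => // -[].
move=> [[Dx Apx]|[[y [Ay Dy] <-]|[Ax /not_orP[? ?]]]].
- by rewrite fD.
- by rewrite fR ?qK//; exact: pD.
- by rewrite fO.
Qed.

Let mD : measurable D. Proof. exact: measurable_pi_dom. Qed.
Let mR : measurable Rg. Proof. exact: measurable_pi_rng. Qed.

Let mDp A : measurable A -> measurable (D `&` phi @^-1` A).
Proof. by move=> mA; exact: (measurable_pi_fun mD mA). Qed.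

Let mpA A : measurable A -> measurable (phi @` (A `&` D)).
Proof.
move=> mA; apply: measurable_pi_image; last exact: subIsetr.
exact: measurableI.
Qed.

Let mO A : measurable A -> measurable (A `&` ~` (D `|` Rg)).
Proof. by move=> mA; apply: measurableI => //; apply/measurableC/measurableU. Qed.

Let mf : measurable_fun setT f.
Proof.
move=> _ A mA; rewrite setTI pre.
by apply: measurableU; [exact: mDp|apply: measurableU; [exact: mpA|exact: mO]].
Qed.

Let f_preserving A : measurable A -> mu (f @^-1` A) = mu A.
Proof.
move=> mA; rewrite pre.
have e1 : mu (D `&` phi @^-1` A) = mu (A `&` Rg).
  rewrite -(@pi_fun_preserving _ _ _ _ phi _ (mDp mA)); last exact: subIsetl.
  congr (mu _); apply/seteqP; split=> [_ [x [Dx Ax] <-]|x [Ax Rx]].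
    by split; [|exact: pD].
  by have [? e] := qR Rx; exists (q x); rewrite ?e//; split => //=; rewrite e.
have e2 : mu (phi @` (A `&` D)) = mu (A `&` D).
  by apply: pi_fun_preserving; [exact: measurableI|exact: subIsetr].
have mAR : measurable (A `&` Rg) by exact: measurableI.
have mAD : measurable (A `&` D) by exact: measurableI.
have mp' := mpA mA; have mO' := mO mA; have mD' := mDp mA.
rewrite [LHS]probability_setU//; first last.
- apply/seteqP; split => // x [[Dx _] [[y [_ Dy] e]|[_ []]]]; last by left.
  by apply: (disj Dx); rewrite -/Rg -e; exact: pD.
- by apply: measurableU.
rewrite e1 probability_setU//; last first.
  apply/seteqP; split => // x [[y [_ Dy] <-] [_ []]]; right; exact: pD.
rewrite [X in (_ + (X + _))%E]e2.
rewrite -[X in (_ + X)%E]measureU//; last first.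
  by apply/seteqP; split => // x [[_ Dx] [_ []]]; left.
rewrite -probability_setU//.
- congr (mu _); apply/seteqP; split=> x; first by move=> [[]|[[]|[]]].
  move=> Ax; have [Dx|Dx] := pselect (D x); first by right; left.
  have [Rx|Rx] := pselect (Rg x); first by left.
  by right; right; split => // -[].
- exact: measurableU.
- apply/seteqP; split => // x [[_ Rx] [[_ Dx]|[_ []]]]; last by right.
  exact: (disj Dx).
Qed.

Definition mp_swap : mp_bij mu := MpBij fK fK mf mf f_preserving.

Lemma mp_swap_dom x : pi_dom phi x -> mp_swap x = phi x.
Proof. exact: fD. Qed.

Lemma mp_swap_img x : pi_dom phi x -> mp_swap (phi x) = x.
Proof. by move=> Dx; rewrite -{1}(mp_swap_dom Dx); exact: fK. Qed.

Lemma mp_swap_out x : ~ pi_dom phi x -> ~ pi_rng phi x -> mp_swap x = x.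
Proof. exact: fO. Qed.

Lemma mp_swapK x : mp_swap (mp_swap x) = x.
Proof. exact: fK. Qed.

End swap.

Section sub_partial_iso.
Variables (phi : partial_iso mu) (C : set T).
Hypotheses (mC : measurable C) (CD : C `<=` pi_dom phi).

Let bij : set_bij C (phi @` C) phi.
Proof.
split; [by move=> x Cx; exists x| |by move=> y].
case: (pi_fun_bij phi) => _ inj _ x y /set_mem Cx /set_mem Cy.
by apply: inj; rewrite inE; exact: CD.
Qed.

Let mCp : measurable (phi @` C). Proof. exact: measurable_pi_image. Qed.

Let mphi : measurable_fun C phi.
Proof. exact: measurable_funS (measurable_pi_dom phi) CD (@measurable_pi_fun _ _ _ _ phi). Qed.

Let mim A : measurable A -> A `<=` C -> measurable (phi @` A).
Proof. by move=> mA AC; apply: measurable_pi_image => //; exact: subset_trans CD. Qed.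

Let pim A : measurable A -> A `<=` C -> mu (phi @` A) = mu A.
Proof. by move=> mA AC; apply: pi_fun_preserving => //; exact: subset_trans CD. Qed.

Definition pi_sub : partial_iso mu := PartialIso mC mCp bij mphi mim pim.

End sub_partial_iso.

Section partial_iso_of_bij.
Variable S : mp_bij mu.

Let bij : set_bij setT setT S.
Proof.
split => //; first by move=> x y _ _; exact: mp_inj.
by move=> y _; exists ((S^-1)%g y) => //; rewrite mpVK.
Qed.

Let mim A : measurable A -> A `<=` setT -> measurable (S @` A).
Proof. by move=> mA _; rewrite mp_image; exact: measurable_mp_preimage. Qed.

Let pim A : measurable A -> A `<=` setT -> mu (S @` A) = mu A.
Proof. by move=> mA _; rewrite mp_image mp_preimage. Qed.

Definition pi_of_mp : partial_iso mu :=
  PartialIso measurableT measurableT bij (measurable_mp S) mim pim.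

End partial_iso_of_bij.

Lemma partial_iso_swap (phi : partial_iso mu) C : measurable C -> C `<=` pi_dom phi ->
  (forall x, C x -> ~ C (phi x)) ->
  exists V : mp_bij mu,
    [/\ forall x, C x -> V x = phi x,
        forall x, C x -> V (phi x) = x,
        forall x, ~ C x -> ~ (phi @` C) x -> V x = x &
        forall x, V (V x) = x].
Proof.
move=> mC CD dC.
have disj x : pi_dom (pi_sub mC CD) x -> pi_rng (pi_sub mC CD) x -> False.
  by move=> /= Cx [y Cy yx]; apply: (dC y) => //; rewrite yx.
exists (mp_swap disj); split.
- exact: (mp_swap_dom disj).
- exact: (mp_swap_img disj).
- exact: (mp_swap_out disj).
- exact: mp_swapK.
Qed.

Lemma exists_mp_swap S C : measurable C -> (forall x, C x -> ~ C (S x)) ->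
  exists V : mp_bij mu,
    [/\ forall x, C x -> V x = S x,
        forall x, C x -> V (S x) = x,
        forall x, ~ C x -> ~ C ((S^-1)%g x) -> V x = x &
        forall x, V (V x) = x].
Proof.
move=> mC dC.
have [V [V1 V2 V3 V4]] := @partial_iso_swap (pi_of_mp S) C mC (@subsetT _ _) dC.
by exists V; split => // x Cx Cx'; apply: V3 => // -[y Cy yx]; apply: Cx'; rewrite -yx mpK.
Qed.

Section eventual_limit.
Variable S_ : nat -> mp_bij mu.
Variables W W' : T -> T.
Hypothesis SW : forall x, exists n, forall m, (n <= m)%N -> S_ m x = W x.
Hypothesis SW' : forall x, exists n, forall m, (n <= m)%N -> (S_ m)^-1%g x = W' x.

Let WK : cancel W W'.
Proof.
move=> x; have [n hn] := SW x; have [m hm] := SW' (W x).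
by rewrite -(hm (maxn n m)) ?leq_maxr// -(hn (maxn n m)) ?leq_maxl// mpK.
Qed.

Let W'K : cancel W' W.
Proof.
move=> x; have [n hn] := SW' x; have [m hm] := SW (W' x).
by rewrite -(hm (maxn n m)) ?leq_maxr// -(hn (maxn n m)) ?leq_maxl// mpVK.
Qed.

Let F (U_ : nat -> mp_bij mu) A n := \bigcap_(m in [set m | (n <= m)%N]) (U_ m @^-1` A).

Let preE (U_ : nat -> mp_bij mu) (V : T -> T) A :
  (forall x, exists n, forall m, (n <= m)%N -> U_ m x = V x) ->
  V @^-1` A = \bigcup_n F U_ A n.
Proof.
move=> UV; apply/seteqP; split=> [x Ax|x [n _ h]] /=.
  by have [n hn] := UV x; exists n => // m /= nm; rewrite /= hn.
have [m hm] := UV x; have := h (maxn n m) (leq_maxl _ _).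
by rewrite /= hm// leq_maxr.
Qed.

Let mF (U_ : nat -> mp_bij mu) A n : measurable A -> measurable (F U_ A n).
Proof.
move=> mA; apply: bigcap_measurable => [|m _]; first by exists n => /=.
exact: measurable_mp_preimage.
Qed.

Let mV (U_ : nat -> mp_bij mu) (V : T -> T) :
  (forall x, exists n, forall m, (n <= m)%N -> U_ m x = V x) ->
  measurable_fun setT V.
Proof.
move=> UV _ A mA; rewrite setTI (preE A UV).
by apply: bigcupT_measurable => n; exact: mF.
Qed.

Let W_le A : measurable A -> (mu (W @^-1` A) <= mu A)%E.
Proof.
move=> mA; rewrite (preE A SW).
have mU : measurable (\bigcup_n F S_ A n) by apply: bigcupT_measurable => n; exact: mF.
have nd : {homo F S_ A : n m / (n <= m)%N >-> (n <= m)%O}.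
  move=> n m nm; apply/subsetPset => x h k /= mk; apply: h.
  exact: leq_trans mk.
have cv := @nondecreasing_cvg_mu _ _ _ mu _ (fun n => mF S_ n mA) mU nd.
rewrite -(cvg_lim _ cv)//; apply: lime_le; first exact: cvgP cv.
apply: nearW => n /=; rewrite -(mp_preimage (S_ n) mA); apply: le_measure.
- by rewrite inE; exact: mF.
- by rewrite inE; exact: measurable_mp_preimage.
- by move=> x /(_ n (leqnn _)).
Qed.

Let W_preserving A : measurable A -> mu (W @^-1` A) = mu A.
Proof.
move=> mA; apply/eqP; rewrite eq_le W_le//=.
have mWA : measurable (W @^-1` A).
  by rewrite -[X in measurable X]setTI; exact: (mV SW).
have := W_le (measurableC mA).
rewrite preimage_setC !probability_setC//.
rewrite -(fineK (fin_num_measure mu _ mA)) -(fineK (fin_num_measure mu _ mWA)).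
by rewrite -!EFinB !lee_fin; lra.
Qed.

(** The preimage of A under the limit is the lower limit of the preimages under the
    [S_ n], so that its measure is at most that of A; applied to the complement of
    A, this bound becomes an equality. *)
Lemma eventual_limit : exists V : mp_bij mu, forall x, V x = W x.
Proof.
by exists (MpBij WK W'K (mV SW)
  (@mV (fun m => (S_ m)^-1%g) _ SW') W_preserving).
Qed.

End eventual_limit.

End mp_bij_group.

(** * The graphing distance *)

Section graphing_distance.
Context d (T : measurableType d) (R : realType) (mu : probability T R).
Variable Phi : set (partial_iso mu).
Local Notation step := (graphing_step Phi).
Local Notation path := (graphing_path Phi).
Local Notation dist := (graphing_dist Phi).

Lemma graphing_step_sym x y : step x y -> step y x.
Proof. by move=> [phi Pphi [h|h]]; exists phi => //; [right|left]. Qed.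

Lemma graphing_path_cat m n x y z : path m x y -> path n y z -> path (m + n) x z.
Proof.
move=> xy; elim: n z => [_ /= ->|n IH z [t /IH xt tz]]; first by rewrite addn0.
by rewrite addnS; exists t.
Qed.

Lemma graphing_path_sym n x y : path n x y -> path n y x.
Proof.
elim: n y => [y /= ->//|n IH y [z /IH zx zy]].
rewrite -add1n; apply: graphing_path_cat zx.
by exists y => //; exact: graphing_step_sym.
Qed.

(** Distances are attained: they are natural numbers or infinite. *)
Lemma graphing_dist_cases x y :
  (dist x y = +oo%E /\ forall n, ~ path n x y) \/
  (exists n, [/\ dist x y = n%:R%:E, path n x y & forall m, path m x y -> (n <= m)%N]).
Proof.
have [[n hn]|np] := pselect (exists n, path n x y); last first.
  left; split; last by move=> n hn; apply: np; exists n.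
  rewrite /graphing_dist (_ : [set n | path n x y] = set0).
    by rewrite image_set0 ereal_inf0.
  by apply/seteqP; split => // n hn; apply: np; exists n.
right; have ex : exists n, `[< path n x y >] by exists n; exact/asboolP.
case: (ex_minnP ex) => m /asboolP pm mmin; exists m; split => //; last first.
  by move=> k /asboolP; exact: mmin.
apply/eqP; rewrite eq_le; apply/andP; split.
  by apply: ereal_inf_lbound; exists m.
apply: le_ereal_inf_tmp => _ [k /= /asboolP/mmin mk <-].
by rewrite lee_fin ler_nat.
Qed.

Lemma graphing_dist_path n x y : path n x y -> (dist x y <= n%:R%:E)%E.
Proof. by move=> pn; apply: ereal_inf_lbound; exists n. Qed.

Lemma graphing_dist_ge0 x y : (0 <= dist x y)%E.
Proof.
by case: (graphing_dist_cases x y) => [[-> _]|[n [-> _ _]]]; rewrite ?leey ?lee_fin.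
Qed.

Lemma graphing_distxx x : dist x x = 0%E.
Proof.
apply/eqP; rewrite eq_le graphing_dist_ge0 andbT.
exact: (@graphing_dist_path 0).
Qed.

Lemma graphing_dist_sym x y : dist x y = dist y x.
Proof.
rewrite /graphing_dist; congr (ereal_inf (_ @` _)).
by apply/seteqP; split=> n; exact: graphing_path_sym.
Qed.

Lemma graphing_dist_triangle y x z : (dist x z <= dist x y + dist y z)%E.
Proof.
case: (graphing_dist_cases x y) => [[-> _]|[n [-> pn _]]].
  by rewrite addye ?leey// gt_eqF// (lt_le_trans _ (graphing_dist_ge0 _ _)).
case: (graphing_dist_cases y z) => [[-> _]|[m [-> pm _]]].
  by rewrite addey ?leey.
by rewrite -EFinD -natrD; apply: graphing_dist_path; exact: graphing_path_cat pm.
Qed.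

Lemma graphing_dist_ge1 x y : x <> y -> (1 <= dist x y)%E.
Proof.
move=> xy; case: (graphing_dist_cases x y) => [[-> _]|[[|n] [-> + _]]].
- by rewrite leey.
- by move=> /esym.
- by rewrite lee_fin ler1n.
Qed.

Lemma graphing_path_rel n x y : path n x y -> graphing_rel Phi x y.
Proof.
elim: n y => [y /= -> E eqE _|n IH y [z /IH xz [phi Pphi h]] E eqE Ephi].
  exact: RelationClasses.Equivalence_Reflexive.
apply: (RelationClasses.Equivalence_Transitive _ z); first exact: xz.
case: h => -[Dz ->]; first exact: Ephi.
by apply: RelationClasses.Equivalence_Symmetric; exact: Ephi.
Qed.

Lemma graphing_rel_path x y : graphing_rel Phi x y -> exists n, path n x y.
Proof.
move=> h; apply: (h (fun x y => exists n, path n x y)) => [|phi z Pphi Dz]; last first.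
  by exists 1%N; exists z => //; exists phi => //; left.
split.
- by move=> a; exists 0%N.
- by move=> a b [n ab]; exists n; exact: graphing_path_sym.
- by move=> a b c [n ab] [m bc]; exists (n + m)%N; exact: graphing_path_cat bc.
Qed.

End graphing_distance.

Section enumeration.
Context d (T : measurableType d) (R : realType) (mu : probability T R).
Variable Phi : set (partial_iso mu).
Hypothesis cPhi : is_graphing Phi.
Variable f : T -> R.
Hypotheses (mf : measurable_fun setT f) (finj : injective f).
Local Notation step := (graphing_step Phi).
Local Notation path := (graphing_path Phi).
Local Notation dist := (graphing_dist Phi).

Let pi0 : partial_iso mu.
Proof.
apply: (@PartialIso _ T R mu set0 set0 id) => //.
- by split => // x y; rewrite inE.
- by move=> A mA; rewrite subset0 => ->; rewrite image_set0.
- by move=> A mA; rewrite subset0 => ->; rewrite image_set0.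
Defined.

Let measurable_cut (phi : partial_iso mu) (q : R) :
  measurable (pi_dom phi `&` [set x | f x < q <= f (phi x)]) /\
  measurable (pi_dom phi `&` [set x | f (phi x) < q <= f x]).
Proof.
have mlt : measurable [set x | f x < q].
  by rewrite -[X in measurable X]setTI; have := mf measurableT (measurable_itv `]-oo, q[);
    congr (measurable (_ `&` _)); apply/seteqP; split=> x /=; rewrite in_itv.
have mge : measurable [set x | q <= f x].
  rewrite (_ : [set x | _] = ~` [set x | f x < q]); first exact: measurableC.
  by apply/seteqP; split=> x /=; rewrite leNgt => /negP.
have mD := measurable_pi_dom phi; have mphi := @measurable_pi_fun _ _ _ _ phi.
split.
  rewrite (_ : _ `&` _ = (pi_dom phi `&` [set x | f x < q]) `&`
                         (pi_dom phi `&` phi @^-1` [set x | q <= f x])).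
    by apply: measurableI; [exact: measurableI|exact: mphi].
  apply/seteqP; split=> x /=; first by case=> ? /andP[? ?].
  by move=> [[? ?] [? ?]]; split => //; apply/andP.
rewrite (_ : _ `&` _ = (pi_dom phi `&` phi @^-1` [set x | f x < q]) `&`
                       (pi_dom phi `&` [set x | q <= f x])).
  by apply: measurableI; [exact: mphi|exact: measurableI].
apply/seteqP; split=> x /=; first by case=> ? /andP[? ?].
by move=> [[? ?] [? ?]]; split => //; apply/andP.
Qed.

Let cut (b : bool) (phi : partial_iso mu) (q : R) : set T :=
  if b then pi_dom phi `&` [set x | f x < q <= f (phi x)]
  else pi_dom phi `&` [set x | f (phi x) < q <= f x].

Let rat_between (a b : R) : a < b -> exists q : rat, a < ratr q <= b.
Proof.
by move=> /rat_in_itvoo[q]; rewrite in_itv/= => /andP[aq /ltW qb]; exists q; rewrite aq.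
Qed.

Lemma countType_enum (I : countType) (i0 : I) :
  exists e : nat -> I, forall i, exists n, e n = i.
Proof.
by exists (fun n => odflt i0 (unpickle n)) => i; exists (pickle i); rewrite pickleK.
Qed.

(** The points that an element of [Phi] moves from one side of a rational level of
    the coordinate to the other form a set disjoint from its image.  Exchanging
    these two sets defines an involution of the whole space; countably many such
    involutions realize all steps of the graphing. *)
Let involutive_generators : exists tau : nat -> mp_bij mu,
  (forall k x, dist x (tau k x) <= 1)%E /\
  (forall x y, y = x \/ step x y -> exists k, y = tau k x).
Proof.
have [e [ePhi Phie]] := countable_range_sub pi0 cPhi.
have swaps (i : nat * rat * bool) : exists V : mp_bij mu,
    (forall x, cut i.2 (e i.1.1) (ratr i.1.2) x ->
       V x = e i.1.1 x /\ V (e i.1.1 x) = x) /\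
    (forall x, dist x (V x) <= 1)%E.
  move: i => [[n q] b] /=; set C := cut _ _ _; set phi := e n.
  have mC : measurable C by rewrite /C /cut; have [] := measurable_cut phi (ratr q); case: b {C}.
  have CD : C `<=` pi_dom phi by rewrite /C /cut; case: b {C mC} => x [].
  have dC x : C x -> ~ C (phi x).
    rewrite /C /cut; case: b {C mC CD} => -[_ /= /andP[a1 a2]] [_ /= /andP[b1 b2]].
      by have := lt_le_trans b1 a2; rewrite ltxx.
    by have := lt_le_trans a1 b2; rewrite ltxx.
  have [V [V1 V2 V3 V4]] := @partial_iso_swap _ _ _ _ phi C mC CD dC.
  exists V; split=> [x Cx|x]; first by rewrite V1// V2.
  have Pphi z : C z -> Phi phi.
    by move=> /CD; rewrite /phi; case: (Phie n) => [->|].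
  have st z : C z -> (dist z (phi z) <= 1)%E.
    move=> Cz; apply: (@graphing_dist_path _ _ _ _ _ 1); exists z => //.
    by exists phi; [exact: (Pphi z)|left; split => //; exact: CD].
  have [Cx|nCx] := pselect (C x); first by rewrite V1//; exact: st.
  have [[z Cz <-]|nI] := pselect ((phi @` C) x).
    by rewrite V2// graphing_dist_sym; exact: st.
  by rewrite V3// graphing_distxx.
have [V hV] := choice swaps.
have [enum enumP] := countType_enum ((0%N, 0, true) : nat * rat * bool).
(* The identity is listed too: it realizes the steps from a point to itself. *)
exists (fun k => if k is k'.+1 then V (enum k') else 1%g); split.
  by move=> [|k] x; [rewrite mp1E graphing_distxx|have [_] := hV (enum k); exact].
have key n b x : (exists q : rat, cut b (e n) (ratr q) x) ->
  exists k, V (enum k) x = e n x /\ V (enum k) (e n x) = x.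
  move=> [q Cx]; have [k ek] := enumP (n, q, b).
  by exists k; rewrite ek; have [+ _] := hV (n, q, b); exact.
have key' n x : pi_dom (e n) x -> e n x <> x ->
  exists k, V (enum k) x = e n x /\ V (enum k) (e n x) = x.
  move=> Dx nx; have : f (e n x) != f x by apply/eqP => /finj.
  rewrite neq_lt => /orP[] /rat_between[q hq].
    by apply: (key n false); exists q.
  by apply: (key n true); exists q.
move=> x y [->|[phi Pphi h]]; first by exists 0%N.
have [->|yx] := pselect (y = x); first by exists 0%N.
have [n en] := ePhi _ Pphi; rewrite -en in h.
case: h => -[D exy].
  have [|k [k1 k2]] := key' n x D; first by rewrite -exy.
  by exists k.+1; rewrite k1.
have [|k [k1 k2]] := key' n y D; first by rewrite -exy => /esym.
by exists k.+1; rewrite [in RHS]exy k2.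
Qed.

Lemma path_enumeration : exists g : nat -> nat -> mp_bij mu,
  (forall n k x, dist x (g n k x) <= n%:R%:E)%E /\
  (forall n x y, path n x y -> exists k, y = g n k x).
Proof.
have [tau [tau1 tau2]] := involutive_generators.
suff h n : exists g : nat -> mp_bij mu, (forall k x, dist x (g k x) <= n%:R%:E)%E /\
    (forall x y, path n x y -> exists k, y = g k x).
  have [g hg] := choice h; exists g.
  by split=> [n k x|n x y]; have [h1 h2] := hg n; [exact: h1|exact: h2].
elim: n => [|n [g [g1 g2]]].
  exists (fun=> 1%g); split=> [k x|x y /= ->]; last by exists 0%N.
  by rewrite mp1E graphing_distxx.
have [enum enumP] := countType_enum ((0%N, 0%N) : nat * nat).
exists (fun k => (tau (enum k).1 * g (enum k).2)%g); split.
  move=> k x; apply: le_trans (graphing_dist_triangle Phi (g (enum k).2 x) _ _) _.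
  by rewrite -natr1 EFinD; exact: leeD (g1 _ _) (tau1 _ _).
move=> x y [z /g2[k ->] zy]; have [l ->] := tau2 _ _ (or_intror zy).
by have [m em] := enumP (l, k); exists m; rewrite em.
Qed.

Lemma orbit_enumeration : exists g : nat -> mp_bij mu,
  (forall k, exists n, forall x, dist x (g k x) <= n%:R%:E)%E /\
  (forall x y, graphing_rel Phi x y <-> exists k, y = g k x).
Proof.
have [g [g1 g2]] := path_enumeration.
have [enum enumP] := countType_enum ((0%N, 0%N) : nat * nat).
have [g' g'E] : exists g' : nat -> mp_bij mu, forall k, g' k = g (enum k).1 (enum k).2.
  by eexists.
exists g'; split=> [k|x y].
  by exists (enum k).1 => x; rewrite g'E.
split=> [/graphing_rel_path[n /g2[k ->]]|[k ->]].
  by have [m em] := enumP (n, k); exists m; rewrite g'E em.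
case: (graphing_dist_cases Phi x (g' k x)) => [[h _]|[n [_ pn _]]].
  by have := g1 (enum k).1 (enum k).2 x; rewrite -g'E h leye_eq.
exact: graphing_path_rel pn.
Qed.

Lemma measurable_eq_points (g h : T -> T) : measurable_fun setT g -> measurable_fun setT h ->
  measurable [set x | g x = h x].
Proof.
move=> mg mh.
have := measurable_fun_eqr (measurableT_comp mf mg) (measurableT_comp mf mh).
move=> /(_ measurableT [set true] I); rewrite setTI => h'.
rewrite (_ : [set x | _] = (fun x => (f \o g) x == (f \o h) x) @^-1` [set true])//.
by apply/seteqP; split=> x /=; [move=> ->; rewrite eqxx|move=> /eqP/finj].
Qed.

(** The distance is at most n exactly when one of countably many bijections, the
    products of n involutive generators, sends the first point to the second. *)
Lemma measurable_graphing_dist (g h : T -> T) :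
  measurable_fun setT g -> measurable_fun setT h ->
  measurable_fun setT (fun x => dist (g x) (h x)).
Proof.
move=> mg mh; have [G [G1 G2]] := path_enumeration.
pose E n := \bigcup_k [set x | G n k (g x) = h x].
pose F n x : \bar R := if pselect (E n x) then n%:R%:E else +oo%E.
have mE n : measurable (E n).
  apply: bigcupT_measurable => k; apply: measurable_eq_points => //.
  by apply: (measurableT_comp (measurable_mp (G n k))).
have mF n : measurable_fun setT (F n).
  rewrite (_ : F n = fun x => if x \in E n then n%:R%:E else +oo%E).
    apply: measurable_fun_ifT => //; apply: (measurable_fun_bool true).
    rewrite setTI (_ : _ @^-1` _ = E n)//.
    by apply/seteqP; split=> x /= => [/set_mem|/mem_set].
  apply/funext => x; rewrite /F; case: pselect => h'; first by rewrite mem_set.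
  by rewrite memNset.
rewrite (_ : (fun x => _) = fun x => einfs (F^~ x) 0%N); first exact: measurable_fun_einfs.
apply/funext => x; apply/eqP; rewrite eq_le; apply/andP; split.
  apply: le_ereal_inf_tmp => _ [n _ <-]; rewrite /F; case: pselect => /= [h'|nh]; last by rewrite leey.
  by case: h' => k _ /= <-; exact: G1.
apply: le_ereal_inf_tmp => _ [n /= /G2[k hk] <-].
apply: (@le_trans _ _ (F n x)); first by apply: ereal_inf_lbound; exists n.
by rewrite /F; case: pselect => // -[]; exists k.
Qed.

End enumeration.

(** * Absolute continuity of the integral *)

Section absolute_continuity.
Context d (T : measurableType d) (R : realType) (mu : probability T R).
Variable w : T -> \bar R.
Hypotheses (mw : measurable_fun setT w) (w0 : forall x, (0 <= w x)%E).
Hypothesis wfin : (\int[mu]_x w x < +oo)%E.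

Let iw : mu.-integrable setT w.
Proof.
apply/integrableP; split => //.
by under eq_integral do rewrite gee0_abs//.
Qed.

Lemma integral_absolutely_continuous (e : R) : 0 < e ->
  exists2 r : R, 0 < r & forall A, measurable A -> (mu A < r%:E)%E ->
    (\int[mu]_(x in A) w x < e%:E)%E.
Proof.
move=> e0.
have wf : {ae mu, forall x, w x = (fine (w x))%:E}.
  by have := integrable_ae measurableT iw; apply: filterS => x /(_ I) h; rewrite fineK.
have mf : measurable_fun setT (fine \o w) by apply: measurableT_comp.
have mfw : measurable_fun setT (EFin \o (fine \o w)) by exact/measurable_EFinP.
have fw x : ((fine (w x))%:E <= w x)%E.
  by move: (w0 x); case: (w x) => //= *; rewrite ?leey.
have f0 x : 0 <= fine (w x) by exact: fine_ge0.
have intA A : measurable A ->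
    (\int[mu]_(x in A) `|(fine \o w) x|%:E = \int[mu]_(x in A) w x)%E.
  move=> mA; apply/esym/ge0_ae_eq_integral => //.
  - exact: measurable_funS mw.
  - apply/measurable_EFinP/measurableT_comp => //; exact: measurable_funS mf.
  - by apply: filterS wf => x h _ /=; rewrite ger0_norm.
have if' : mu.-integrable setT (EFin \o (fine \o w)).
  apply/integrableP; split => //.
  by rewrite (_ : (\int[mu]_x _)%E = (\int[mu]_x w x)%E)// -intA.
have [r [r0 hr]] := integral_normr_continuous if' e0.
exists r => // A mA Ar; have := hr A mA Ar.
rewrite /Rintegral -lte_fin fineK intA// ge0_fin_numE ?integral_ge0//.
by apply: le_lt_trans wfin; apply: ge0_subset_integral.
Qed.

(** The sets need not shrink to a null set, only to one where [w] vanishes: the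
    parts of the [F n] on which [w] does not vanish do shrink to a null set. *)
Lemma integral_decreasing_small (F : nat -> set T) (e : R) :
  (forall n, measurable (F n)) -> (forall n, F n.+1 `<=` F n) ->
  {ae mu, forall x, (forall n, F n x) -> w x = 0%E} -> 0 < e ->
  exists n, (\int[mu]_(x in F n) w x < e%:E)%E.
Proof.
move=> mF ndF F0 e0.
have [r r0 hr] := integral_absolutely_continuous e0.
pose P := [set x | w x != 0%E].
have mP : measurable P.
  by have := emeasurable_neq measurableT mw 0%E; rewrite setTI.
pose G n := F n `&` P.
have mG n : measurable (G n) by exact: measurableI.
have ndG : {homo G : n m / (n <= m)%N >-> (m <= n)%O}.
  apply/nonincreasing_seqP => n; apply/subsetPset => x [Fx Px]; split => //.
  exact: ndF.
have mGG : measurable (\bigcap_n G n) by exact: bigcapT_measurable.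
have G00 : (mu (G 0%N) < +oo)%E by rewrite ltey_eq fin_num_measure.
have G0 : mu (\bigcap_n G n) = 0%E.
  apply/negligibleP => //; apply: negligibleS F0 => x /= Gx hx.
  have [_ /= /eqP] := Gx 0%N I; apply; apply: hx => n.
  by have [] := Gx n I.
have cv : mu (G n) @[n --> \oo] --> 0%E by rewrite -G0; exact: nonincreasing_cvg_mu.
have [n hn] : exists n, (mu (G n) < r%:E)%E.
  apply: contrapT => no; suff : (r%:E <= 0)%E by rewrite lee_fin leNgt r0.
  apply: (cvge_ge _ cv); apply: nearW => n; rewrite leNgt; apply/negP => h.
  by apply: no; exists n.
exists n; apply: le_lt_trans (hr _ (mG n) hn) => //=.
rewrite (_ : F n = G n `|` (F n `&` ~` P)); last by rewrite -setIUr setUv setIT.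
have mFP : measurable (F n `&` ~` P) by apply: measurableI => //; exact: measurableC.
rewrite ge0_integral_setU//.
- rewrite [X in (_ + X)%E]integral0_eq ?adde0//.
  by move=> x [_ /= /negP]; rewrite negbK => /eqP.
- exact: measurable_funS mw.
- by apply/disj_setPS => x [[_ ?] []].
Qed.

End absolute_continuity.

(** * The metric of the L1 full group on measure-preserving bijections *)

Section L1_metric.
Context d (T : measurableType d) (R : realType) (mu : probability T R).
Variable Phi : set (partial_iso mu).
Local Notation dist := (graphing_dist Phi).
Hypothesis mdist : forall g h : T -> T, measurable_fun setT g ->
  measurable_fun setT h -> measurable_fun setT (fun x => dist (g x) (h x)).
Hypothesis meq : forall g h : T -> T, measurable_fun setT g ->
  measurable_fun setT h -> measurable [set x | g x = h x].
Implicit Types S U V W : mp_bij mu.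

Definition mp_dist S U : \bar R := (\int[mu]_x dist (S x) (U x))%E.

Definition mp_L1 S : Prop := (mp_dist 1%g S < +oo)%E.

Lemma measurable_mp_dist S U : measurable_fun setT (fun x => dist (S x) (U x)).
Proof. by apply: mdist; exact: measurable_mp. Qed.

Lemma measurable_mp_displacement S : measurable_fun setT (fun x => dist x (S x)).
Proof. exact: (measurable_mp_dist 1%g). Qed.

Lemma mp_dist_ge0 S U : (0 <= mp_dist S U)%E.
Proof. by apply: integral_ge0 => x _; exact: graphing_dist_ge0. Qed.

Lemma mp_distxx S : mp_dist S S = 0%E.
Proof. by apply: integral0_eq => x _; exact: graphing_distxx. Qed.

Lemma mp_dist_sym S U : mp_dist S U = mp_dist U S.
Proof. by apply: eq_integral => x _; exact: graphing_dist_sym. Qed.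

Lemma mp_dist_triangle U S V : (mp_dist S V <= mp_dist S U + mp_dist U V)%E.
Proof.
rewrite /mp_dist -ge0_integralD//=; try by move=> *; exact: graphing_dist_ge0.
- apply: ge0_le_integral => //; try by move=> *; exact: graphing_dist_ge0.
  + exact: measurable_mp_dist.
  + by apply: emeasurable_funD; exact: measurable_mp_dist.
  + by move=> x _; exact: graphing_dist_triangle.
- exact: measurable_mp_dist.
- exact: measurable_mp_dist.
Qed.

Lemma mp_dist_mulr V S U : mp_dist (S * V)%g (U * V)%g = mp_dist S U.
Proof.
apply: (mp_integral V (F := fun x => dist (S x) (U x))).
  exact: measurable_mp_dist.
by move=> x; exact: graphing_dist_ge0.
Qed.

Lemma mp_L1_1 : mp_L1 1%g.
Proof. by rewrite /mp_L1 mp_distxx. Qed.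

Lemma mp_L1_near S U : mp_L1 S -> (mp_dist S U < +oo)%E -> mp_L1 U.
Proof.
move=> hS hU; apply: le_lt_trans (mp_dist_triangle S _ _) _.
exact: lte_add_pinfty.
Qed.

Lemma mp_L1V S : mp_L1 S -> mp_L1 S^-1%g.
Proof. by move=> hS; rewrite /mp_L1 -(mp_dist_mulr S) mul1g mulVg mp_dist_sym. Qed.

Lemma mp_L1M S U : mp_L1 S -> mp_L1 U -> mp_L1 (S * U)%g.
Proof.
move=> hS hU; apply: (mp_L1_near hU).
by rewrite -[X in mp_dist X _]mul1g mp_dist_mulr.
Qed.

Lemma mp_L1X S n : mp_L1 S -> mp_L1 (S ^+ n)%g.
Proof.
move=> hS; elim: n => [|n IH]; first exact: mp_L1_1.
by rewrite expgS; exact: mp_L1M.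
Qed.

Lemma mp_L1_piecewise S U V : mp_L1 S -> mp_L1 U ->
  (forall x, [\/ V x = x, V x = S x | V x = U x]) -> mp_L1 V.
Proof.
move=> hS hU hV.
apply: (@le_lt_trans _ _ (mp_dist 1%g S + mp_dist 1%g U)%E); last exact: lte_add_pinfty.
rewrite /mp_dist -ge0_integralD//=; try by move=> *; exact: graphing_dist_ge0.
- apply: ge0_le_integral => //; try by move=> *; exact: graphing_dist_ge0.
  + exact: measurable_mp_displacement.
  + by apply: emeasurable_funD; exact: measurable_mp_displacement.
  + move=> x _; case: (hV x) => ->.
    * by rewrite graphing_distxx adde_ge0// graphing_dist_ge0.
    * by rewrite leeDl// graphing_dist_ge0.
    * by rewrite leeDr// graphing_dist_ge0.
- exact: measurable_mp_displacement.
- exact: measurable_mp_displacement.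
Qed.

Lemma mp_L1_restr S V : mp_L1 S -> (forall x, V x = x \/ V x = S x) -> mp_L1 V.
Proof.
move=> hS hV; apply: (mp_L1_piecewise hS hS) => x.
by case: (hV x); [constructor 1|constructor 2].
Qed.

Lemma mp_dist_ae S U : {ae mu, forall x, S x = U x} -> mp_dist S U = 0%E.
Proof.
move=> SU; rewrite -[RHS](@integral0 _ _ _ mu setT).
apply: ge0_ae_eq_integral => //.
- exact: measurable_mp_dist.
- by move=> x _; exact: graphing_dist_ge0.
- by apply: filterS SU => x -> _; rewrite graphing_distxx.
Qed.

(** Where two bijections differ their values are at distance at least one, so
    closeness of bijections bounds the measure of the set where they differ. *)
Lemma measure_neq_le S U : (mu [set x | S x <> U x] <= mp_dist S U)%E.
Proof.
have mE : measurable [set x | S x <> U x].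
  by apply: measurableC; apply: meq; exact: measurable_mp.
rewrite -[X in (X <= _)%E]mul1e -(integral_cst mu mE 1).
apply: (@le_trans _ _ (\int[mu]_(x in [set x | S x <> U x]) dist (S x) (U x))%E).
  apply: ge0_le_integral => //.
  - by apply: measurable_funS (measurable_mp_dist S U).
  - by move=> x /= /(graphing_dist_ge1 Phi).
apply: ge0_subset_integral => //; first exact: measurable_mp_dist.
by move=> *; exact: graphing_dist_ge0.
Qed.

(** Multiplication on the left is not isometric: a map close to another one can
    still be sent far away by [W] on the small set where the two maps differ;
    absolute continuity of the displacement of [W] controls that error. *)
Lemma mp_mull_continuous W (e : R) : mp_L1 W -> 0 < e ->
  exists2 r : R, 0 < r & forall S U, (mp_dist S U < r%:E)%E ->
    (mp_dist (W * S)%g (W * U)%g < e%:E)%E.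
Proof.
move=> hW e0; pose w x := dist x (W x).
have mw : measurable_fun setT w by exact: measurable_mp_displacement.
have w0 x : (0 <= w x)%E by exact: graphing_dist_ge0.
have e30 : 0 < e / 3 by rewrite divr_gt0.
have [r r0 hr] := integral_absolutely_continuous mw w0 hW e30.
exists (Order.min r (e / 3)); first by rewrite lt_min r0.
move=> S U; rewrite EFin_min lt_min => /andP[SUr SUe].
pose F := [set x | S x <> U x].
have mF : measurable F.
  by apply: measurableC; apply: meq; exact: measurable_mp.
have small V : (\int[mu]_(x in F) w (V x) < (e / 3)%:E)%E.
  have -> : F = V @^-1` (V @` F).
    apply/seteqP; split=> [x Fx|x [y Fy /mp_inj <-]//].
    by exists x.
  have mVF : measurable (V @` F) by rewrite mp_image; exact: measurable_mp_preimage.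
  rewrite (mp_integral_preimage V mVF mw w0); apply: hr => //.
  rewrite mp_image mp_preimage//; apply: le_lt_trans SUr.
  exact: measure_neq_le.
have mwV V : measurable_fun F (fun x => w (V x)).
  apply: measurable_funS measurableT _ _ => //.
  exact: (measurableT_comp mw (measurable_mp V)).
have mdF : measurable_fun F (fun x => dist (S x) (U x)).
  by apply: measurable_funS measurableT _ (measurable_mp_dist S U).
apply: (@le_lt_trans _ _ (\int[mu]_(x in F) (w (S x) + (dist (S x) (U x) + w (U x))))%E).
  apply: (@le_trans _ _ (\int[mu]_(x in F) dist (W (S x)) (W (U x)))%E).
    rewrite /mp_dist -(setUv F) ge0_integral_setU//.
    - rewrite [X in (_ + X)%E]integral0_eq ?adde0// => x /= /contrapT ->.
      by rewrite graphing_distxx.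
    - exact: measurableC.
    - by rewrite setUv; exact: measurable_mp_dist.
    - by move=> *; exact: graphing_dist_ge0.
    - by apply/disj_setPS => x [].
  apply: ge0_le_integral => //.
  - by move=> *; exact: graphing_dist_ge0.
  - exact: measurable_funS measurableT _ (measurable_mp_dist (W * S)%g (W * U)%g).
  - by apply: emeasurable_funD => //; apply: emeasurable_funD.
  - move=> x _; apply: le_trans (graphing_dist_triangle Phi (S x) _ _) _.
    rewrite graphing_dist_sym leeD2l//; exact: graphing_dist_triangle.
rewrite ge0_integralD//; last 2 first.
- by move=> x _; rewrite adde_ge0// graphing_dist_ge0.
- exact: emeasurable_funD.
rewrite ge0_integralD//; last by move=> *; exact: graphing_dist_ge0.
have -> : e = e / 3 + (e / 3 + e / 3) by lra.
rewrite !EFinD; apply: lteD; first exact: small.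
apply: lteD; last exact: small.
apply: le_lt_trans SUe; apply: ge0_subset_integral => //.
  exact: measurable_mp_dist.
by move=> *; exact: graphing_dist_ge0.
Qed.

(** The closure for the pseudometric [mp_dist]; since bijections that agree almost
    everywhere are at distance zero, it is saturated for almost everywhere equality. *)
Definition mp_closure (H : set (mp_bij mu)) : set (mp_bij mu) :=
  [set S | forall e : R, 0 < e -> exists2 h, H h & (mp_dist S h < e%:E)%E].

Lemma sub_mp_closure H : H `<=` mp_closure H.
Proof. by move=> S HS e e0; exists S => //; rewrite mp_distxx. Qed.

Lemma mp_closureS H K : H `<=` K -> mp_closure H `<=` mp_closure K.
Proof. by move=> HK S hS e /hS[h /HK]; exists h. Qed.

Lemma mp_closureK H : mp_closure (mp_closure H) `<=` mp_closure H.
Proof.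
move=> S hS e e0; have e20 : 0 < e / 2 by rewrite divr_gt0.
have [U hU SU] := hS _ e20; have [h Hh Uh] := hU _ e20.
exists h => //; apply: le_lt_trans (mp_dist_triangle U _ _) _.
by rewrite [e]splitr EFinD lteD.
Qed.

Lemma mp_closure_L1 H : H `<=` mp_L1 -> mp_closure H `<=` mp_L1.
Proof.
move=> HL S /(_ 1 ltr01)[h /HL hL Sh]; apply: (mp_L1_near hL).
by rewrite mp_dist_sym; apply: lt_trans Sh _; rewrite ltry.
Qed.

Lemma mp_closure_ae H S U : {ae mu, forall x, S x = U x} ->
  mp_closure H U -> mp_closure H S.
Proof.
move=> SU hU e /hU[h Hh Uh]; exists h => //.
by apply: le_lt_trans (mp_dist_triangle U _ _) _; rewrite (mp_dist_ae SU) add0e.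
Qed.

Section closure_of_subgroup.
Variable H : set (mp_bij mu).
Hypotheses (H1 : H 1%g) (HM : forall S U, H S -> H U -> H (S * U)%g)
  (HV : forall S, H S -> H S^-1%g) (HL : H `<=` mp_L1).

Lemma mp_closureM S U : mp_closure H S -> mp_closure H U -> mp_closure H (S * U)%g.
Proof.
move=> hS hU e e0; have e20 : 0 < e / 2 by rewrite divr_gt0.
have [r r0 hr] := mp_mull_continuous (mp_closure_L1 HL hS) e20.
have [u Hu Uu] := hU _ r0; have [s Hs Ss] := hS _ e20.
exists (s * u)%g; first exact: HM.
apply: le_lt_trans (mp_dist_triangle (S * u)%g _ _) _.
rewrite [e]splitr EFinD lteD//; first exact: hr.
by rewrite mp_dist_mulr.
Qed.

Lemma mp_closureV S : mp_closure H S -> mp_closure H S^-1%g.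
Proof.
move=> hS e e0.
have [r r0 hr] := mp_mull_continuous (mp_L1V (mp_closure_L1 HL hS)) e0.
have [s Hs Ss] := hS _ r0; exists s^-1%g; first exact: HV.
rewrite -(mp_dist_mulr s) mulVg -(mulVg S) mp_dist_sym.
exact: hr.
Qed.

Lemma mp_closureJ W S : mp_L1 W -> (forall s, H s -> H (W * s * W^-1)%g) ->
  mp_closure H S -> mp_closure H (W * S * W^-1)%g.
Proof.
move=> hW HJ hS e e0; have [r r0 hr] := mp_mull_continuous hW e0.
have [s Hs Ss] := hS _ r0; exists (W * s * W^-1)%g; first exact: HJ.
by rewrite mp_dist_mulr; exact: hr.
Qed.

End closure_of_subgroup.

End L1_metric.

(** * Recurrence *)

Section recurrence.
Context d (T : measurableType d) (R : realType) (mu : probability T R).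
Implicit Types (S U V W : mp_bij mu) (A Q : set T).

Lemma mpX_subV S i n x : (i <= n)%N -> (S ^+ i)%g ((S^-1 ^+ n)%g x) = (S^-1 ^+ (n - i))%g x.
Proof. by move=> h; rewrite -{1}(subnKC h) mpXD mpXVK. Qed.

Lemma mpXV_sub S i n x : (i <= n)%N -> (S^-1 ^+ i)%g ((S ^+ n)%g x) = (S ^+ (n - i))%g x.
Proof. by move=> h; rewrite -{1}(subnKC h) mpXD mpXK. Qed.

Definition saturation S A : set T :=
  \bigcup_n ((S ^+ n)%g @^-1` A `|` (S^-1 ^+ n)%g @^-1` A).

Lemma saturation_meas S A : measurable A -> measurable (saturation S A).
Proof.
by move=> mA; apply: bigcupT_measurable => n; apply: measurableU; exact: measurable_mp_preimage.
Qed.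

Lemma saturation_inv S A x : saturation S A (S x) <-> saturation S A x.
Proof.
split=> -[n _ []] /=.
- by rewrite -mpXSr => h; exists n.+1 => //; left.
- case: n => [|n]; first by move=> h; exists 1%N => //; left.
  by rewrite mpXSr mpK => h; exists n => //; right.
- case: n => [|n]; last by rewrite mpXSr => h; exists n => //; left.
  move=> h; exists 1%N => //; right.
  by suff : A ((S^-1)%g (S x)) by []; rewrite mpK.
- by move=> h; exists n.+1 => //; right => /=; rewrite mpXSr mpK.
Qed.

Lemma sub_saturation S A : A `<=` saturation S A.
Proof. by move=> x Ax; exists 0%N => //; left. Qed.

Lemma saturation_null S A : mu.-negligible A -> mu.-negligible (saturation S A).
Proof.
by move=> A0; apply: negligible_bigcup => n; apply: negligibleU; exact: mp_negligible.
Qed.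

(** The set of points whose forward orbit meets [Q] is the disjoint union of [Q] and
    of its own preimage, which has the same finite measure. *)
Lemma wandering_null S Q : measurable Q ->
  (forall x n, Q x -> ~ Q ((S ^+ n.+1)%g x)) -> mu Q = 0%E.
Proof.
move=> mQ wQ; pose G := \bigcup_n ((S ^+ n)%g @^-1` Q).
have mG : measurable G by apply: bigcupT_measurable => n; exact: measurable_mp_preimage.
have GE : G = Q `|` S @^-1` G.
  apply/seteqP; split=> [x [[|n] _ h]|x [Qx|[n _ h]]].
  - by left.
  - by right; exists n => //; move: h => /=; rewrite mpXSr.
  - by exists 0%N.
  - by exists n.+1 => //; move: h => /=; rewrite -mpXSr.
have QG : Q `&` S @^-1` G = set0.
  apply/seteqP; split => // x [Qx [n _ /=]].
  by rewrite -mpXSr; exact: wQ.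
have := probability_setU mu mQ (measurable_mp_preimage S mG) QG.
rewrite -GE mp_preimage// -(fineK (fin_num_measure mu _ mG)) -(fineK (fin_num_measure mu _ mQ)).
by rewrite -EFinD => -[] h; congr EFin; lra.
Qed.

End recurrence.

(** * First-return maps and products of involutions *)

Section involutive_products.
Context d (T : measurableType d) (R : realType) (mu : probability T R).
Variable Phi : set (partial_iso mu).
Local Notation dist := (graphing_dist Phi).
Implicit Types S U V W : mp_bij mu.

(** These products form a group because involutions are their own inverses. *)
Inductive involutive_product : mp_bij mu -> Prop :=
| Involutive_product1 : involutive_product 1%g
| Involutive_productM S V : involutive_product S -> mp_L1 Phi V ->
    (V * V = 1)%g -> involutive_product (S * V)%g.

Lemma involutive_product_invol V : mp_L1 Phi V -> (V * V = 1)%g -> involutive_product V.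
Proof.
by move=> hV VV; rewrite -(mul1g V); apply: Involutive_productM => //; exact: Involutive_product1.
Qed.

Lemma involutive_productMM S U : involutive_product S -> involutive_product U ->
  involutive_product (S * U)%g.
Proof.
move=> hS; elim=> [|U' V hU' IH hV VV]; first by rewrite mulg1.
by rewrite mulgA; exact: Involutive_productM.
Qed.

Lemma involutive_productV S : involutive_product S -> involutive_product S^-1%g.
Proof.
elim=> [|U V hU IH hV VV]; first by rewrite invg1; exact: Involutive_product1.
rewrite invgM (_ : V^-1 = V)%g; last exact: mulg1_eq.
by apply: involutive_productMM => //; exact: involutive_product_invol.
Qed.

Hypothesis mdist : forall g h : T -> T, measurable_fun setT g ->
  measurable_fun setT h -> measurable_fun setT (fun x => dist (g x) (h x)).
Hypothesis meq : forall g h : T -> T, measurable_fun setT g ->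
  measurable_fun setT h -> measurable [set x | g x = h x].

Lemma involutive_product_L1 : involutive_product `<=` mp_L1 Phi.
Proof.
by move=> S; elim=> [|U V _ IH hV _]; [exact: mp_L1_1|exact: mp_L1M].
Qed.

Lemma involutive_productJ W S : mp_L1 Phi W -> involutive_product S ->
  involutive_product (W * S * W^-1)%g.
Proof.
move=> hW; elim=> [|U V hU IH hV VV]; first by rewrite mulg1 mulgV; exact: Involutive_product1.
rewrite (_ : _ * _ = (W * U * W^-1) * (W * V * W^-1))%g; last by rewrite !mulgA mulgVK.
apply: Involutive_productM => //.
  by apply: mp_L1M => //; [exact: mp_L1M|exact: mp_L1V].
by rewrite !mulgA mulgVK -(mulgA W) VV mulg1 mulgV.
Qed.

Local Notation clE := (mp_closure Phi involutive_product).

Section first_return.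
Variables (S : mp_bij mu) (A : set T).
Hypotheses (hS : mp_L1 Phi S) (mA : measurable A).
Hypothesis return_A : forall x, A x -> exists n, A ((S ^+ n.+1)%g x).
Hypothesis reach_A : forall x, (forall n, ~ A ((S^-1 ^+ n)%g x)) -> S x = x.

(* Points are classified by the times at which their orbits visit [A]: those of
   [A_ m] are about to stay out of [A] for at least m + 1 steps. *)
Let A_ m : set T := [set x | A x /\ forall i, (i <= m)%N -> ~ A ((S ^+ i.+1)%g x)].
(* Those of [D_ m] were in [A] for the last time exactly m + 1 steps ago. *)
Let D_ m : set T := (S^-1 ^+ m.+1)%g @^-1` A_ m.
(* Those of [K_ m] are out of [A] now and were so during the last m steps. *)
Let K_ m : set T := [set x | forall i, (i <= m)%N -> ~ A ((S^-1 ^+ i)%g x)].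

Let mA_ m : measurable (A_ m).
Proof.
rewrite (_ : A_ m = A `&` \bigcap_(i in [set i | (i <= m)%N]) ~` ((S ^+ i.+1)%g @^-1` A)).
  apply: measurableI => //; apply: bigcap_measurable => [|i _]; first by exists 0%N.
  by apply: measurableC; exact: measurable_mp_preimage.
by apply/seteqP; split.
Qed.

Let mD_ m : measurable (D_ m).
Proof. exact: measurable_mp_preimage. Qed.

Let mK_ m : measurable (K_ m).
Proof.
rewrite (_ : K_ m = \bigcap_(i in [set i | (i <= m)%N]) ~` ((S^-1 ^+ i)%g @^-1` A)).
  apply: bigcap_measurable => [|i _]; first by exists 0%N.
  by apply: measurableC; exact: measurable_mp_preimage.
by apply/seteqP; split.
Qed.

Let D_A_ m x : A_ m x -> D_ m ((S ^+ m.+1)%g x).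
Proof. by move=> Ax; rewrite /D_ /preimage /= mpXK. Qed.

Let A_D_ m : A_ m = (S ^+ m.+1)%g @^-1` D_ m.
Proof. by apply/seteqP; split=> x; rewrite /D_ /preimage /= mpXK. Qed.

Let A_notA m x : A_ m x -> ~ A ((S ^+ m.+1)%g x).
Proof. by move=> [_]; apply. Qed.

Let D_A m x : D_ m x -> A ((S^-1 ^+ m.+1)%g x).
Proof. by case. Qed.

Let D_K m : D_ m `<=` K_ m.
Proof.
move=> x [_ h] i im; have := h (m - i)%N (leq_subr _ _).
rewrite mpX_subV ?ltnS ?leq_subr// subSS subKn//.
Qed.

Let K_split m : K_ m = K_ m.+1 `|` D_ m.
Proof.
apply/seteqP; split=> x; last first.
  by move=> [h i im|]; [apply: h; exact: leqW|exact: D_K].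
move=> Kx; have [Ax|Ax] := pselect (A ((S^-1 ^+ m.+1)%g x)); last first.
  left=> i; rewrite leq_eqVlt => /orP[/eqP ->//|]; rewrite ltnS; exact: Kx.
right; split => // i im; rewrite mpX_subV ?ltnS// subSS; apply: Kx.
exact: leq_subr.
Qed.

Let K_D_disj m : K_ m.+1 `&` D_ m = set0.
Proof. by apply/seteqP; split => // x [Kx /D_A]; exact: Kx. Qed.

Let D_uniq m n x : (m < n)%N -> D_ m x -> ~ D_ n x.
Proof.
move=> mn /D_A Ax [_ /(_ (n - m.+1)%N (leq_subr _ _))].
rewrite mpX_subV; last by rewrite ltnS leq_subr.
by rewrite subSS subKn.
Qed.

Let D_finite x : exists N, forall m, (N <= m)%N -> ~ D_ m x.
Proof.
have [[n Dn]|nD] := pselect (exists n, D_ n x).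
  by exists n.+1 => m nm; exact: D_uniq Dn.
by exists 0%N => m _ Dm; apply: nD; exists m.
Qed.

Let A_finite x : exists N, forall m, (N <= m)%N -> ~ A_ m x.
Proof.
have [Ax|nAx] := pselect (A x); last by exists 0%N => m _ [].
have [n An] := return_A Ax; exists n => m nm [_ /(_ n nm)]; exact.
Qed.

Let swaps m : exists V : mp_bij mu,
  [/\ forall x, A_ m x -> V x = (S ^+ m.+1)%g x,
      forall x, D_ m x -> V x = (S^-1 ^+ m.+1)%g x,
      forall x, ~ A_ m x -> ~ D_ m x -> V x = x,
      (V * V = 1)%g & mp_L1 Phi V].
Proof.
have [|V [V1 V2 V3 V4]] := @exists_mp_swap _ _ _ _ (S ^+ m.+1)%g _ (mA_ m).
  by move=> x /A_notA nA [].
have V2' x : D_ m x -> V x = (S^-1 ^+ m.+1)%g x.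
  by move=> Dx; rewrite -[in LHS](mpXVK S m.+1 x) V2.
have V3' x : ~ A_ m x -> ~ D_ m x -> V x = x.
  by move=> nA nD; apply: V3 => //; rewrite -expVgn.
exists V; split => //; first exact: mp_bij_ext.
apply: (@mp_L1_piecewise _ _ _ _ _ mdist (S ^+ m.+1)%g (S^-1 ^+ m.+1)%g).
- exact: mp_L1X.
- by apply: mp_L1X => //; exact: mp_L1V.
- move=> x; have [Ax|nA] := pselect (A_ m x); first by constructor 2; exact: V1.
  have [Dx|nD] := pselect (D_ m x); first by constructor 3; exact: V2'.
  by constructor 1; exact: V3'.
Qed.

(** Multiply [S] successively by the involutions [t m] exchanging each point of
    [A_ m] with its image in [D_ m] under the power m + 1 of [S].  The factor [t m]
    turns the points of [D_ m] into fixed points.  The product [S_ m] of [S] with the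
    first m factors thus moves only points of [A] and of [K_ m]; it sends a point of
    [A] to its first return to [A], or m + 1 steps ahead if that comes first.  Passing
    from [S_ m] to the next product costs twice the integral of the displacement of
    [S] over [D_ m].  The sets [D_ k] with k at least m are disjoint parts of [K_ m],
    and the integral over [K_ m] tends to zero because [S] fixes the points whose past
    avoids [A]; Fatou's lemma turns these estimates into convergence to the limit. *)
Lemma first_return_map : exists W : mp_bij mu,
  [/\ mp_L1 Phi W, forall x, ~ A x -> W x = x & clE (S^-1 * W)%g].
Proof.
have [t ht] := choice swaps.
pose P := fix P m : mp_bij mu := if m is k.+1 then (P k * t k)%g else 1%g.
pose S_ m := (S * P m)%g.
have SS m x : S_ m.+1 x = S_ m (t m x) by [].
have t_fix m x : ~ A_ m x -> ~ D_ m x -> t m x = x by have [_ _ + _ _] := ht m; exact.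
have tA m x : A_ m x -> t m x = (S ^+ m.+1)%g x by have [+ _ _ _ _] := ht m; exact.
have tD m x : D_ m x -> t m x = (S^-1 ^+ m.+1)%g x by have [_ + _ _ _] := ht m; exact.
have tt m : (t m * t m = 1)%g by have [_ _ _ + _] := ht m.
have tL m : mp_L1 Phi (t m) by have [_ _ _ _ +] := ht m.
have PE m : involutive_product (P m).
  by elim: m => [|m IH]; [exact: Involutive_product1|exact: Involutive_productM].
have S_K m x : K_ m x -> S_ m x = S x.
  elim: m x => [//|m IH] x Kx; have [Km Dm] : K_ m x /\ ~ D_ m x.
    split; first by rewrite K_split; left.
    by move=> Dx; have : (K_ m.+1 `&` D_ m) x by []; rewrite K_D_disj.
  by rewrite SS t_fix//; [exact: IH|move=> [Ax _]; exact: (Kx 0%N)].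
have S_A m x : A_ m x -> S_ m x = (S ^+ m.+1)%g x.
  case: m => [//|m] [Ax h]; have Am : A_ m x by split=> // i im; apply: h; exact: leqW.
  by rewrite SS tA// S_K -?mpXS//; apply: D_K; exact: D_A_.
have S_D m x : D_ m x -> S_ m.+1 x = x.
  by move=> Dx; rewrite SS tD// S_A// mpXVK.
(* Each point is moved by finitely many of the involutions, and so is each point
   of the target, so that the products converge pointwise together with their
   inverses. *)
have stab (x : T) N : (forall m, (N <= m)%N -> t m x = x) ->
    forall m, (N <= m)%N -> S_ m x = S_ N x.
  move=> h; elim=> [|m IH]; first by rewrite leqn0 => /eqP ->.
  by rewrite leq_eqVlt => /orP[/eqP ->//|]; rewrite ltnS => Nm; rewrite SS h// IH.
have evt x : exists N, forall m, (N <= m)%N -> t m x = x.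
  have [N hN] := A_finite x; have [M hM] := D_finite x; exists (maxn N M) => m.
  by rewrite geq_max => /andP[Nm Mm]; apply: t_fix; [exact: hN|exact: hM].
have evS x : exists y, exists N, forall m, (N <= m)%N -> S_ m x = y.
  by have [N /stab h] := evt x; exists (S_ N x), N.
have evV y : exists x, exists N, forall m, (N <= m)%N -> (S_ m)^-1%g y = x.
  have [N hN] := D_finite y; have [M hM] := D_finite (S^-1%g y).
  exists ((S_ (maxn N M))^-1%g y), (maxn N M).
  elim=> [|m IH]; first by rewrite leqn0 => /eqP ->.
  rewrite leq_eqVlt => /orP[/eqP ->//|]; rewrite ltnS => Lm; rewrite -(IH Lm).
  move: Lm; rewrite geq_max => /andP[Nm Mm].
  set x := (S_ m)^-1%g y; have xy : S_ m x = y by rewrite /x mpVK.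
  have tx : t m x = x.
    apply: t_fix => [Ax|Dx].
      by apply: (hN m Nm); rewrite -xy S_A//; exact: D_A_.
    by apply: (hM m Mm); rewrite -xy S_K ?mpK//; exact: D_K.
  by apply: (@mp_inj _ _ _ _ (S_ m.+1)); rewrite mpVK SS tx.
have [W0 hW0] := choice evS; have [W1 hW1] := choice evV.
have [W hW] := eventual_limit hW0 hW1.
have WA x : ~ A x -> W x = x.
  move=> nA; rewrite hW; have [N hN] := hW0 x.
  have [[m Dx]|nD] := pselect (exists m, D_ m x).
    have h n : (m.+1 <= n)%N -> t n x = x.
      by move=> mn; apply: t_fix => [[]//|]; exact: D_uniq Dx.
    have hh := stab _ _ h.
    by rewrite -(hN (maxn N m.+1)) ?leq_maxl// hh ?leq_maxr// S_D.
  have Kx m : K_ m x.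
    elim: m => [|m IH]; first by move=> i; rewrite leqn0 => /eqP ->.
    by move: IH; rewrite K_split => -[//|Dm]; case: nD; exists m.
  by rewrite -(hN N)// S_K//; apply: reach_A => n; exact: (Kx n).
pose u x := dist x (S x).
have mu_ : measurable_fun setT u by exact: measurable_mp_displacement.
have u0 x : (0 <= u x)%E by exact: graphing_dist_ge0.
pose kap m := (\int[mu]_(x in K_ m) u x)%E.
pose c m := (\int[mu]_(x in D_ m) u x)%E.
have kapS m : kap m = (kap m.+1 + c m)%E.
  rewrite /kap K_split ge0_integral_setU//; first exact: measurable_funS measurableT _ mu_.
  by apply/disj_set2P; rewrite K_D_disj.
have kap0 m : (0 <= kap m)%E by exact: integral_ge0.
have c0 m : (0 <= c m)%E by exact: integral_ge0.
have stepd m : (mp_dist Phi (S_ m) (S_ m.+1) <= c m + c m)%E.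
  pose F1 := ((fun x => u ((S ^+ m.+1)%g x)) \_ (A_ m)).
  pose F2 := (u \_ (D_ m)).
  have m1 : measurable_fun setT F1.
    apply/(measurable_restrictT _ (mA_ m)); apply: measurable_funS measurableT _ _ => //.
    exact: (measurableT_comp mu_ (measurable_mp _)).
  have m2 : measurable_fun setT F2.
    by apply/(measurable_restrictT _ (mD_ m)); apply: measurable_funS measurableT _ mu_.
  have F10 x : (0 <= F1 x)%E by rewrite /F1 patchE; case: ifP.
  have F20 x : (0 <= F2 x)%E by rewrite /F2 patchE; case: ifP.
  apply: (@le_trans _ _ (\int[mu]_x (F1 x + F2 x))%E); last first.
    rewrite ge0_integralD// -!integral_mkcond leeD// A_D_.
    by rewrite mp_integral_preimage.
  apply: ge0_le_integral => //.
  - by move=> *; exact: graphing_dist_ge0.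
  - exact: measurable_mp_dist.
  - exact: emeasurable_funD.
  move=> x _; rewrite SS; have [Ax|nA] := pselect (A_ m x).
    apply: (@le_trans _ _ (F1 x)); last by rewrite leeDl.
    rewrite /F1 patchE mem_set// tA// S_A// S_K; last by apply: D_K; exact: D_A_.
    by [].
  have [Dx|nD] := pselect (D_ m x); last first.
    by rewrite t_fix// graphing_distxx adde_ge0.
  apply: (@le_trans _ _ (F2 x)); last by rewrite leeDr.
  rewrite /F2 patchE mem_set// -SS S_D// S_K; last exact: D_K.
  by rewrite graphing_dist_sym.
have sumd m j : (mp_dist Phi (S_ m) (S_ (m + j)%N) + (kap (m + j)%N + kap (m + j)%N)
                 <= kap m + kap m)%E.
  elim: j => [|j IH]; first by rewrite addn0 mp_distxx add0e.
  apply: le_trans IH; rewrite addnS.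
  set k := (m + j)%N; rewrite (kapS k).
  apply: (@le_trans _ _ (mp_dist Phi (S_ m) (S_ k) + (c k + c k) + (kap k.+1 + kap k.+1))%E).
    rewrite leeD2r//; apply: le_trans (mp_dist_triangle mdist (S_ k) _ _) _.
    by rewrite leeD2l.
  rewrite -[X in (X <= _)%E]addeA; apply: leeD2l.
  by rewrite [X in (_ <= X)%E]addeACA [X in (_ <= X)%E]addeC.
have limd m : (mp_dist Phi (S_ m) W <= kap m + kap m)%E.
  pose f j x := dist (S_ m x) (S_ (m + j)%N x).
  have mf j : measurable_fun setT (f j) by exact: measurable_mp_dist.
  have f0 j x : setT x -> (0 <= f j x)%E by move=> _; exact: graphing_dist_ge0.
  have -> : mp_dist Phi (S_ m) W = (\int[mu]_x limn_einf (f^~ x))%E.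
    apply: eq_integral => x _.
    have [N hN] := hW0 x; have cv : f^~ x @ \oo --> dist (S_ m x) (W x).
      apply: cvg_near_cst; exists N => // j /= Nj.
      by rewrite /f hW (hN (m + j)%N)// (leq_trans Nj)// leq_addl.
    by rewrite is_cvg_limn_einfE ?(cvg_lim _ cv)//; exact: cvgP cv.
  apply: le_trans (fatou mu measurableT mf f0) _.
  rewrite limn_einf_lim; apply: lime_le; first exact: is_cvg_einfs.
  apply: nearW => n; apply: (@le_trans _ _ (mp_dist Phi (S_ m) (S_ (m + n)%N))).
    by apply: ereal_inf_lbound; exists n => //=.
  by apply: le_trans (sumd m n); rewrite leeDl// adde_ge0.
have small (e : R) : 0 < e -> exists m, (mp_dist Phi (S_ m) W < e%:E)%E.
  move=> e0; have e20 : 0 < e / 2 by rewrite divr_gt0.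
  have [//||m hm] := @integral_decreasing_small _ _ _ mu u mu_ u0 hS K_ (e / 2) mK_ _ _ e20.
  - by move=> n x Kx i im; apply: Kx; exact: leqW.
  - apply: aeW => x Kx; rewrite /u reach_A ?graphing_distxx// => n.
    exact: (Kx n n).
  by exists m; apply: le_lt_trans (limd m) _; rewrite [e]splitr EFinD lteD.
have hWL : mp_L1 Phi W.
  have [m hm] := small 1 ltr01; apply: (mp_L1_near mdist (S := S_ m)).
    by apply: mp_L1M => //; exact: involutive_product_L1.
  by apply: lt_trans hm _; rewrite ltry.
exists W; split => // e e0.
have [r r0 hr] := mp_mull_continuous mdist meq (mp_L1V mdist hS) e0.
have [m hm] := small _ r0; exists (P m) => //.
by rewrite (_ : P m = S^-1 * S_ m)%g; [apply: hr; rewrite mp_dist_sym|rewrite /S_ mulKg].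
Qed.

End first_return.
End involutive_products.

(** * Commutators are limits of products of involutions *)

Section commutators.
Context d (T : measurableType d) (R : realType) (mu : probability T R).
Variable Phi : set (partial_iso mu).
Local Notation dist := (graphing_dist Phi).
Hypothesis mdist : forall g h : T -> T, measurable_fun setT g ->
  measurable_fun setT h -> measurable_fun setT (fun x => dist (g x) (h x)).
Hypothesis meq : forall g h : T -> T, measurable_fun setT g ->
  measurable_fun setT h -> measurable [set x | g x = h x].
Implicit Types S U V W : mp_bij mu.
Local Notation clE := (mp_closure Phi (involutive_product Phi)).

Lemma invariantX S (Y : set T) n x : (forall x, Y (S x) <-> Y x) ->
  (Y ((S ^+ n)%g x) <-> Y x).
Proof.
by move=> SY; elim: n => // n IH; rewrite mpXS; apply: iff_trans IH; exact: SY.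
Qed.

Lemma invariantV S (Y : set T) x : (forall x, Y (S x) <-> Y x) -> (Y (S^-1%g x) <-> Y x).
Proof. by move=> SY; rewrite -(SY (S^-1%g x)) mpVK. Qed.

Lemma invariantXV S (Y : set T) n x : (forall x, Y (S x) <-> Y x) ->
  (Y ((S^-1 ^+ n)%g x) <-> Y x).
Proof. by move=> SY; apply: invariantX => y; exact: invariantV. Qed.

(** Poincare recurrence: the points of [A] that never come back wander. *)
Lemma last_visits_null S (A : set T) : measurable A ->
  mu.-negligible [set x | A x /\ forall n, ~ A ((S ^+ n.+1)%g x)].
Proof.
move=> mA; set Q := [set x | _].
have mQ : measurable Q.
  rewrite (_ : Q = A `&` \bigcap_n ~` ((S ^+ n.+1)%g @^-1` A)).
    apply: measurableI => //; apply: bigcapT_measurable => n.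
    by apply: measurableC; exact: measurable_mp_preimage.
  by apply/seteqP; split=> x [Ax h]; split => // n; [move=> _; exact: h|exact: h].
by apply/negligibleP => //; apply: (@wandering_null _ _ _ _ S) => // x n [_ h] [] /h.
Qed.

(** The first-return map to [A], for a set [A] that meets the orbit of almost
    every point moved by [S].  The points of [A] that never return, in the
    future or in the past, and the orbits that violate the hypothesis, form a
    null set, outside of which recurrence is unconditional. *)
Lemma first_return_map_ae S (A : set T) : mp_L1 Phi S -> measurable A ->
  (forall K, measurable K -> (forall x, K (S x) <-> K x) ->
     (forall x, K x -> ~ A x) -> {ae mu, forall x, K x -> S x = x}) ->
  exists W, [/\ mp_L1 Phi W, forall x, ~ A x -> W x = x & clE (S^-1 * W)%g].
Proof.
move=> hS mA meet.
pose Q1 := [set x | A x /\ forall n, ~ A ((S ^+ n.+1)%g x)].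
pose Q2 := [set x | A x /\ forall n, ~ A ((S^-1 ^+ n.+1)%g x)].
pose K := ~` saturation S A.
pose Q3 := [set x | ~ (K x -> S x = x)].
have Q0 : mu.-negligible (Q1 `|` Q2 `|` Q3).
  apply: negligibleU; first by apply: negligibleU; exact: last_visits_null.
  apply: meet.
  - by apply: measurableC; exact: saturation_meas.
  - by move=> x; rewrite /K /=; apply: not_iff_compat; exact: saturation_inv.
  - by move=> x Kx Ax; apply: Kx; exact: sub_saturation.
have [B [mB B0 QB]] := Q0.
pose N := saturation S B; pose Y := ~` N.
have mY : measurable Y by apply: measurableC; exact: saturation_meas.
have SY x : Y (S x) <-> Y x by apply: not_iff_compat; exact: saturation_inv.
have YB x : Y x -> ~ (Q1 `|` Q2 `|` Q3) x by move=> Yx /QB Bx; apply: Yx; exact: sub_saturation.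
pose S' := mp_restr mY SY; pose A' := A `&` Y.
have S'x x : S' x = x \/ S' x = S x.
  by have [Yx|Yx] := pselect (Y x); [right; exact: mp_restr_in|left; exact: mp_restr_out].
have hS' : mp_L1 Phi S' by exact: (mp_L1_restr mdist hS).
have ret x : A' x -> exists n, A' ((S' ^+ n.+1)%g x).
  move=> [Ax Yx]; apply: contrapT => no; apply: (YB x Yx); left; left; split => // n An.
  by apply: no; exists n; rewrite mp_restrX_in//; split => //; exact/(invariantX _ _ SY).
have rea x : (forall n, ~ A' ((S'^-1 ^+ n)%g x)) -> S' x = x.
  move=> h; have [Yx|nY] := pselect (Y x); last exact: mp_restr_out.
  have nA n : ~ A ((S^-1 ^+ n)%g x).
    by move=> An; apply: (h n); rewrite mp_restrXV_in//; split => //; exact/(invariantXV _ _ SY).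
  rewrite mp_restr_in//; apply: contrapT => Sx.
  have [n0 An0] : exists n, A ((S ^+ n)%g x).
    apply: contrapT => no; apply: (YB x Yx); right => /(_ _)/Sx; apply.
    by move=> [n _ [An|An]]; [apply: no; exists n|exact: (nA n)].
  have ex : exists n, `[< A ((S ^+ n)%g x) >] by exists n0; exact/asboolP.
  case: (ex_minnP ex) => n /asboolP An nmin.
  have Yn : Y ((S ^+ n)%g x) by exact/(invariantX _ _ SY).
  apply: (YB _ Yn); left; right; split => // k.
  have [kn|nk] := ltnP k n.
    rewrite mpXV_sub// => /asboolP/nmin.
    by rewrite leqNgt ltn_subrL/= (leq_ltn_trans _ kn).
  have := nA (k.+1 - n)%N.
  by rewrite -{2}(subnK (leqW nk)) mpXD mpXK.
have [W [hW WA cW]] := first_return_map mdist meq hS' (measurableI _ _ mA mY) ret rea.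
exists W; split => //; first by move=> x nA; apply: WA => -[].
apply: mp_closure_ae cW => //.
have : mu.-negligible (W @^-1` N).
  apply: mp_negligible; apply: saturation_null.
  exact/negligibleP.
apply: negligibleS => x h; apply: contrapT => Yx; apply: h.
by suff : S^-1%g (W x) = S'^-1%g (W x) by []; rewrite mp_restrV_in.
Qed.

(** On an invariant set where [S] never increases [f], an orbit crosses each rational
    level at most once, so that the crossing points form a wandering set; a point at
    which [f] strictly decreases crosses some rational level. *)
Lemma fixed_ae_of_nonincreasing (f : T -> R) S : measurable_fun setT f -> injective f ->
  forall K, measurable K -> (forall x, K (S x) <-> K x) ->
  (forall x, K x -> ~ (f x < f (S x))) -> {ae mu, forall x, K x -> S x = x}.
Proof.
move=> mf finj K mK SK Kdec.
have dec x : K x -> f (S x) <= f x by move=> /Kdec /negP; rewrite -leNgt.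
have mfS : measurable_fun setT (f \o S) by apply: measurableT_comp => //; exact: measurable_mp.
have mlt (g : T -> R) q : measurable_fun setT g -> measurable [set x | g x < q].
  move=> mg; rewrite (_ : [set x | _] = g @^-1` `]-oo, q[%classic); last first.
    by apply/seteqP; split=> x /=; rewrite in_itv.
  by rewrite -[X in measurable X]setTI; apply: mg.
pose Q (q : rat) := K `&` [set x | f (S x) < ratr q] `&` ~` [set x | f x < ratr q].
have mQ q : measurable (Q q).
  apply: measurableI; last by apply: measurableC; exact: mlt.
  by apply: measurableI => //; exact: mlt mfS.
have Q0 q : mu.-negligible (Q q).
  apply/negligibleP => //; apply: (@wandering_null _ _ _ _ S) => // x n [[Kx fSx] _] [_ /=].
  apply; elim: n => // n IH; rewrite mpXS; apply: le_lt_trans IH; apply: dec.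
  exact/(invariantX _ _ SK).
have [e eP] := countType_enum (0 : rat).
have : mu.-negligible (\bigcup_n Q (e n)) by exact: negligible_bigcup.
apply: negligibleS => x /= /not_implyP[Kx Sx].
have : f (S x) < f x.
  by rewrite lt_neqAle dec// andbT; apply/eqP => /finj.
move=> /rat_in_itvoo[q]; rewrite in_itv/= => /andP[q1 q2].
have [n en] := eP q; exists n => //; rewrite en; split; first by split.
by move=> /=; rewrite ltNge (ltW q2).
Qed.

Lemma disjoint_support_commute S U (A B : set T) :
  (forall x, ~ A x -> S x = x) -> (forall x, ~ B x -> U x = x) ->
  (forall x, A x -> ~ B x) -> (S * U = U * S)%g.
Proof.
move=> SA UB AB; apply: mp_bij_ext => x; rewrite !mpME.
have stable V (C : set T) y : (forall z, ~ C z -> V z = z) -> C y -> C (V y).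
  move=> VC Cy; apply: contrapT => nC; have := VC _ nC => /mp_inj e.
  by apply: nC; rewrite e.
have [Ax|nA] := pselect (A x).
  by rewrite (UB x) ?(UB (S x)) => //; apply: AB => //; exact: stable Ax.
rewrite (SA x)//; have [Bx|nB] := pselect (B x); last by rewrite (UB x)// SA.
by rewrite SA// => /AB; apply; exact: stable Bx.
Qed.

Let clM S U : clE S -> clE U -> clE (S * U)%g.
Proof.
apply: mp_closureM => //; first exact: involutive_productMM.
exact: involutive_product_L1.
Qed.

Let clV S : clE S -> clE S^-1%g.
Proof.
apply: mp_closureV => //; first exact: involutive_productV.
exact: involutive_product_L1.
Qed.

Let clJ W S : mp_L1 Phi W -> clE S -> clE (W * S * W^-1)%g.
Proof.
move=> hW; apply: mp_closureJ => // s; exact: involutive_productJ.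
Qed.

Let sim S U := clE (S^-1 * U)%g.

Let sim_refl S : sim S S.
Proof. by rewrite /sim mulVg; apply: sub_mp_closure; exact: Involutive_product1. Qed.

Let sim_sym S U : sim S U -> sim U S.
Proof. by move=> /clV; rewrite /sim invgM invgK. Qed.

Let sim_trans U S V : sim S U -> sim U V -> sim S V.
Proof. by move=> SU UV; have := clM SU UV; rewrite mulgA mulgK. Qed.

Let simM S S' U U' : mp_L1 Phi U -> sim S S' -> sim U U' -> sim (S * U)%g (S' * U')%g.
Proof.
move=> hU SS UU; have := clM (clJ (mp_L1V mdist hU) SS) UU.
by rewrite /sim invgK invgM !mulgA mulgK.
Qed.

(** The first-return maps of [S] to the set [A1] where [S] increases the
    coordinate and to the set [A2] where it decreases it both agree with [S]
    modulo limits of products of involutions.  The part of [U] on the orbits that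
    leave [A1] agrees likewise with a map supported off [A1], and the other part
    of [U] is supported in [A1], hence off [A2].  Each part of [U] thus commutes
    with one of the representatives of [S]. *)
Lemma commutator_in_closure (f : T -> R) S U : measurable_fun setT f -> injective f ->
  mp_L1 Phi S -> mp_L1 Phi U -> clE [~ S, U]%g.
Proof.
move=> mf finj hS hU.
pose A1 := [set x | f x < f (S x)]; pose A2 := [set x | - f x < - f (S x)].
have mlt (g : T -> R) : measurable_fun setT g -> measurable [set x | g x < g (S x)].
  move=> mg; have mgS : measurable_fun setT (g \o S).
    by apply: measurableT_comp => //; exact: measurable_mp.
  have := measurable_fun_ltr mg mgS measurableT (Y := [set true]) I; rewrite setTI.
  by congr measurable; apply/seteqP; split.
have mA1 : measurable A1 by exact: mlt.
have mA2 : measurable A2 by apply: (mlt (fun x => - f x)); exact: measurableT_comp.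
have A12 x : A1 x -> ~ A2 x.
  by rewrite /A1 /A2 /= ltrN2 => h1 h2; have := lt_trans h1 h2; rewrite ltxx.
have [W1 [hW1 W1A SW1]] := first_return_map_ae hS mA1 (fixed_ae_of_nonincreasing mf finj).
have [W2 [hW2 W2A SW2]] : exists W,
    [/\ mp_L1 Phi W, forall x, ~ A2 x -> W x = x & clE (S^-1 * W)%g].
  apply: first_return_map_ae => //; apply: (@fixed_ae_of_nonincreasing (fun x => - f x)).
    exact: measurableT_comp.
  by move=> x y /oppr_inj/finj.
pose Z := saturation U (~` A1).
have mZ : measurable Z by apply: saturation_meas; exact: measurableC.
have UZ x : Z (U x) <-> Z x by exact: saturation_inv.
have mZ' : measurable (~` Z) by exact: measurableC.
have UZ' x : (~` Z) (U x) <-> (~` Z) x by apply: not_iff_compat.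
pose U1 := mp_restr mZ UZ; pose U2 := mp_restr mZ' UZ'.
have U1x x : U1 x = x \/ U1 x = U x.
  by have [Zx|Zx] := pselect (Z x); [right; exact: mp_restr_in|left; exact: mp_restr_out].
have U2x x : U2 x = x \/ U2 x = U x.
  by have [Zx|Zx] := pselect ((~` Z) x); [right; exact: mp_restr_in|left; exact: mp_restr_out].
have hU1 : mp_L1 Phi U1 by exact: (mp_L1_restr mdist hU).
have hU2 : mp_L1 Phi U2 by exact: (mp_L1_restr mdist hU).
have UE : U = (U1 * U2)%g.
  apply: mp_bij_ext => x; rewrite mpME; have [Zx|nZ] := pselect (Z x).
    by rewrite (@mp_restr_out _ _ _ _ _ _ mZ' UZ' x) ?mp_restr_in// => /(_ Zx).
  by rewrite (@mp_restr_in _ _ _ _ _ _ mZ' UZ' x)// mp_restr_out// => /UZ.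
have [V1 [hV1 V1A UV1]] : exists W,
    [/\ mp_L1 Phi W, forall x, ~ (~` A1) x -> W x = x & clE (U1^-1 * W)%g].
  apply: first_return_map_ae => //; first exact: measurableC.
  move=> K mK UK KA; apply: aeW => x Kx.
  have [Zx|nZ] := pselect (Z x); last exact: mp_restr_out.
  case: (Zx) => n _ [] h; exfalso.
    by apply: (KA ((U1 ^+ n)%g x)); [exact/(invariantX _ _ UK)|rewrite mp_restrX_in].
  by apply: (KA ((U1^-1 ^+ n)%g x)); [exact/(invariantXV _ _ UK)|rewrite mp_restrXV_in].
have U2A x : ~ A1 x -> U2 x = x.
  by move=> nA; apply: mp_restr_out; apply; exact: sub_saturation.
have c1 : (W1 * V1 = V1 * W1)%g.
  by apply: (disjoint_support_commute W1A V1A) => x A1x; apply.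
have c2 : (U2 * W2 = W2 * U2)%g by exact: (disjoint_support_commute U2A W2A).
suff : sim (U * S)%g (S * U)%g.
  by rewrite /sim invgM commgEl conjgE !mulgA.
apply: sim_sym; rewrite UE.
apply: (@sim_trans (W1 * V1 * U2)%g).
  by rewrite mulgA; apply: simM => //; exact: simM.
rewrite c1; apply: (@sim_trans (V1 * (W2 * U2))%g).
  rewrite -mulgA; apply: simM => //; first exact: mp_L1M.
  apply: simM => //; apply: sim_trans SW2; exact: sim_sym.
rewrite -c2 mulgA; apply: sim_sym; apply: simM => //.
exact: simM.
Qed.

End commutators.

(** * Involutions are limits of products of commutators *)

Section commutator_of_swaps.
Context d (T : measurableType d) (R : realType) (mu : probability T R).
Variable Phi : set (partial_iso mu).
Local Notation dist := (graphing_dist Phi).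
Hypothesis mdist : forall g h : T -> T, measurable_fun setT g ->
  measurable_fun setT h -> measurable_fun setT (fun x => dist (g x) (h x)).
Variables (t g : mp_bij mu) (A C : set T).
Hypotheses (ht : mp_L1 Phi t) (hg : mp_L1 Phi g) (tt : forall x, t (t x) = x).
Hypotheses (mC : measurable C) (tA : forall x, A x -> ~ A (t x)).
Hypotheses (CA : C `<=` A) (gCA : forall x, C x -> A (g x)).
Hypothesis gC : forall x, C x -> ~ C (g x).
Let E := C `|` g @` C.

(** Let T1 exchange [C] with its image under [t].  Its conjugate by the involution w,
    which exchanges [C] with [g @` C] along [g] and the images of these sets along
    the conjugate of [g] by [t], exchanges [g @` C] with its image under [t].  Since
    T1 is an involution, the product of T1 and its conjugate is a commutator. *)
Lemma involution_piece_commutator : exists T1 w, [/\ mp_L1 Phi T1, mp_L1 Phi w,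
  forall x, E x \/ E (t x) -> [~ T1, w]%g x = t x &
  forall x, ~ E x -> ~ E (t x) -> [~ T1, w]%g x = x].
Proof.
have tV x : t^-1%g x = t x by rewrite -{1}(tt x) mpK.
have [T1 [a1 a2 a3 a4]] : exists V : mp_bij mu,
    [/\ forall x, C x -> V x = t x, forall x, C x -> V (t x) = x,
        forall x, ~ C x -> ~ C (t^-1%g x) -> V x = x & forall x, V (V x) = x].
  by apply: exists_mp_swap => // x /CA/tA nA /CA.
have [v [b1 b2 b3 b4]] := exists_mp_swap mC gC.
have T1id x : ~ C x -> ~ C (t x) -> T1 x = x by move=> ? ?; apply: a3; rewrite ?tV.
have vA x : A x -> A (v x).
  move=> Ax; have [Cx|nC] := pselect (C x); first by rewrite b1//; exact: gCA.
  have [Cg|nCg] := pselect (C (g^-1%g x)); last by rewrite b3.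
  by rewrite -(mpVK g x) b2//; exact: CA.
have vN x : ~ A x -> v x = x.
  move=> nA; apply: b3 => [/CA//|/gCA]; by rewrite mpVK.
pose w := (v * (t * v * t))%g.
have wE x : w x = v (t (v (t x))) by [].
have wA x : A x -> w x = v x.
  by move=> Ax; rewrite wE (vN (t x)) ?tt//; exact: tA.
have wtA x : A (t x) -> w x = t (v (t x)).
  by move=> Ax; rewrite wE vN//; apply: tA; exact: vA.
have wN x : ~ A x -> ~ A (t x) -> w x = x.
  by move=> nA nAt; rewrite wE (vN _ nAt) tt vN.
have ww x : w (w x) = x.
  have [Ax|nA] := pselect (A x); first by rewrite (wA _ Ax) wA ?b4//; exact: vA.
  have [At|nAt] := pselect (A (t x)); last by rewrite !wN.
  by rewrite (wtA _ At) wtA tt ?b4 ?tt//; exact: vA.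
have T1V x : T1^-1%g x = T1 x by rewrite -{1}(a4 x) mpK.
have wV x : w^-1%g x = w x by rewrite -{1}(ww x) mpK.
have cE x : [~ T1, w]%g x = T1 (w (T1 (w x))) by rewrite commgEl conjgE !mpME T1V wV.
have hT1 : mp_L1 Phi T1.
  apply: (mp_L1_restr mdist ht) => x.
  have [Cx|nC] := pselect (C x); first by right; exact: a1.
  have [Ct|nCt] := pselect (C (t x)); last by left; exact: T1id.
  by right; rewrite -{1}(tt x) a2.
have hv : mp_L1 Phi v.
  apply: (mp_L1_piecewise mdist hg (mp_L1V mdist hg)) => x.
  have [Cx|nC] := pselect (C x); first by constructor 2; exact: b1.
  have [Cg|nCg] := pselect (C (g^-1%g x)); last by constructor 1; exact: b3.
  by constructor 3; rewrite -{1}(mpVK g x) b2.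
exists T1, w; split => //.
- by apply: mp_L1M => //; apply: mp_L1M => //; exact: mp_L1M.
- move=> x h; rewrite cE.
  have T1A y : A y -> ~ C y -> T1 y = y.
    by move=> Ay nC; apply: T1id => // /CA; exact: tA.
  have T1tA y : A y -> ~ C y -> T1 (t y) = t y.
    by move=> Ay nC; apply: T1id; [move=> /CA; exact: tA|rewrite tt].
  case: h => [[Cx|[y Cy <-]]|[Cx|[y Cy yx]]].
  + have Ax := CA Cx; have Agx := gCA Cx; have nCgx := gC Cx.
    by rewrite (wA x)// b1// (T1A (g x))// wA// b2// a1.
  + have Ay := CA Cy; have Agy := gCA Cy; have nCgy := gC Cy.
    by rewrite (wA (g y))// b2// (a1 y)// wtA ?tt// b1// T1tA.
  + have Ax := CA Cx; have Agx := gCA Cx; have nCgx := gC Cx.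
    by rewrite (wtA x)// b1// (T1tA (g (t x)))// wtA ?tt// b2// a2.
  + have Ay := CA Cy; have Agy := gCA Cy; have nCgy := gC Cy.
    have -> : x = t (g y) by rewrite yx tt.
    by rewrite (wtA (t (g y))) tt// b2// (a2 y)// wA// b1// T1A.
- move=> x nE nEt; rewrite cE.
  have vid y : ~ E y -> v y = y.
    move=> nEy; apply: b3 => Cy; apply: nEy; first by left.
    by right; exists (g^-1%g y) => //; rewrite mpVK.
  have wx : w x = x by rewrite wE (vid (t x))// tt vid.
  have T1x : T1 x = x by apply: T1id => Cx; [apply: nE|apply: nEt]; left.
  by rewrite wx T1x wx T1x.
Qed.

End commutator_of_swaps.

Section involutions.
Context d (T : measurableType d) (R : realType) (mu : probability T R).
Variable Phi : set (partial_iso mu).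
Local Notation dist := (graphing_dist Phi).
Hypothesis mdist : forall g h : T -> T, measurable_fun setT g ->
  measurable_fun setT h -> measurable_fun setT (fun x => dist (g x) (h x)).
Hypothesis meq : forall g h : T -> T, measurable_fun setT g ->
  measurable_fun setT h -> measurable [set x | g x = h x].
Hypothesis aper : aperiodic Phi.
Variable f : T -> R.
Hypotheses (mf : measurable_fun setT f) (finj : injective f).
Variable g : nat -> mp_bij mu.
Hypothesis g_bounded : forall k, exists n, forall x, (dist x (g k x) <= n%:R%:E)%E.
Hypothesis g_orbit : forall x y, graphing_rel Phi x y <-> exists k, y = g k x.

(** In a measure-preserving aperiodic relation a set [Z] meeting each class at
    most once is null: the maps [g k], each restricted to the points of [Z] where
    its value is new, have disjoint images, while almost every point of [Z] lies
    in infinitely many of these restricted domains. *)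
Lemma partial_transversal_null (Z : set T) : measurable Z ->
  (forall x y, Z x -> Z y -> graphing_rel Phi x y -> x = y) -> mu.-negligible Z.
Proof.
move=> mZ Zuniq.
have relE x y : graphing_rel Phi x y -> graphing_rel Phi y x.
  by move=> /graphing_rel_path[n /graphing_path_sym]; exact: graphing_path_rel.
have relT x y z : graphing_rel Phi x y -> graphing_rel Phi y z -> graphing_rel Phi x z.
  move=> /graphing_rel_path[n xy] /graphing_rel_path[m yz].
  exact: graphing_path_rel (graphing_path_cat xy yz).
pose F k := Z `&` \bigcap_(j in [set j | (j < k)%N]) ~` [set x | g j x = g k x].
have mF k : measurable (F k).
  apply: measurableI => //; apply: bigcap_measurableType => j _.
  by apply: measurableC; apply: meq; exact: measurable_mp.
have mgF k : measurable (g k @` F k) by rewrite mp_image; exact: measurable_mp_preimage.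
have disj : trivIset setT (fun k => g k @` F k).
  have key i j x y : (i < j)%N -> F i x -> F j y -> g i x = g j y -> False.
    move=> ij [Zx _] [Zy /(_ i ij) ny] e; apply: ny => /=.
    suff xy : x = y by rewrite -{1}xy.
    apply: Zuniq => //; apply: (relT _ (g i x)); first by apply/g_orbit; exists i.
    by apply: relE; rewrite e; apply/g_orbit; exists j.
  move=> i j _ _ [z [[x Fx <-] [y Fy e]]].
  have [ij|ji|//] := ltngtP i j; exfalso; first exact: (key _ _ _ _ ij Fx Fy (esym e)).
  exact: (key _ _ _ _ ji Fy Fx e).
have fin : (\sum_(0 <= k <oo) mu (F k) < +oo)%E.
  rewrite (@eq_eseriesr _ _ (fun k => mu (g k @` F k))); last first.
    by move=> k _; rewrite mp_image mp_preimage.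
  rewrite -(measure_semi_bigcup mu mgF disj); last exact: bigcupT_measurable.
  apply: (@le_lt_trans _ _ 1%E); last by rewrite ltry.
  by apply: probability_le1; exact: bigcupT_measurable.
have Flim := lim_sup_set_cvg0 mF fin.
have mlim : measurable (lim_sup_set F).
  by apply: bigcapT_measurable => n; apply: bigcup_measurable.
have : mu.-negligible (lim_sup_set F `|`
    ~` [set x | infinite_set [set y | graphing_rel Phi x y]]).
  by apply: negligibleU; [exact/negligibleP|exact: aper].
apply: negligibleS => x Zx.
have [infx|] := pselect (infinite_set [set y | graphing_rel Phi x y]); last by right.
left=> n _; apply: contrapT => no; apply: infx.
apply: (@sub_finite_set _ _ ((fun k => g k x) @` `I_n)); last exact/finite_image/finite_II.
move=> y /= /g_orbit[k ->].
have ex : exists i, `[< g i x = g k x >] by exists k; exact/asboolP.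
case: (ex_minnP ex) => i /asboolP ik imin; exists i => //=.
rewrite ltnNge; apply/negP => ni; apply: no; exists i => //; split => // j /= ji e.
have /imin : `[< g j x = g k x >] by apply/asboolP; rewrite -ik.
by rewrite leqNgt ji.
Qed.

Lemma g_L1 k : mp_L1 Phi (g k).
Proof.
have [n hn] := g_bounded k.
apply: (@le_lt_trans _ _ (\int[mu]_x (cst n%:R%:E) x)%E).
  apply: ge0_le_integral => //; first by move=> *; exact: graphing_dist_ge0.
  exact: (measurable_mp_displacement mdist).
rewrite integral_cst// lte_mul_pinfty ?lee_fin//.
by have := probability_setT mu => /= ->; rewrite ltry.
Qed.

Lemma measurable_lt_point (h1 h2 : T -> R) :
  measurable_fun setT h1 -> measurable_fun setT h2 ->
  measurable [set x | h1 x < h2 x].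
Proof.
move=> m1 m2; have := measurable_fun_ltr m1 m2 measurableT (Y := [set true]) I.
by rewrite setTI; congr measurable; apply/seteqP; split.
Qed.

Section greedy.
Variable t : mp_bij mu.
Hypotheses (ht : mp_L1 Phi t) (tt : forall x, t (t x) = x).
Variable H : set (mp_bij mu).
Hypotheses (H1 : H 1%g) (HM : forall S U, H S -> H U -> H (S * U)%g).
Hypothesis HR : forall S U, mp_L1 Phi S -> mp_L1 Phi U -> H [~ S, U]%g.

Let A := [set x | f x < f (t x)].

Variable stage : nat -> nat * rat.
Hypothesis stageP : forall s, exists k, stage k = s.

Let piece (B : set T) (s : nat * rat) : set T :=
  [set x | [/\ B x, B (g s.1 x), f x < ratr s.2 & ~ f (g s.1 x) < ratr s.2]].

Let A_ := fix A_ k : set T := if k is n.+1 then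
  A_ n `\` (piece (A_ n) (stage n) `|` g (stage n).1 @` piece (A_ n) (stage n)) else A.

Let C_ k := piece (A_ k) (stage k).
Let g_ k := g (stage k).1.
Let E_ k := C_ k `|` g_ k @` C_ k.

Let A_S k : A_ k.+1 = A_ k `\` E_ k. Proof. by []. Qed.

Let mA : measurable A.
Proof.
by apply: measurable_lt_point => //; apply: measurableT_comp => //; exact: measurable_mp.
Qed.

Let mC k : measurable (A_ k) -> measurable (C_ k).
Proof.
move=> mAk; have mlt (h : T -> R) : measurable_fun setT h ->
    measurable [set x | h x < ratr (stage k).2].
  by move=> mh; apply: measurable_lt_point.
rewrite (_ : C_ k = (A_ k `&` g_ k @^-1` A_ k) `&`
   ([set x | f x < ratr (stage k).2] `&` ~` [set x | (f \o g_ k) x < ratr (stage k).2])).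
  apply: measurableI; first by apply: measurableI => //; exact: measurable_mp_preimage.
  apply: measurableI; first exact: mlt.
  apply: measurableC; apply: mlt; apply: measurableT_comp => //; exact: measurable_mp.
by apply/seteqP; split=> x; [move=> []|move=> [[? ?] []]].
Qed.

Let mA_ k : measurable (A_ k).
Proof.
elim: k => [|k IH]; first exact: mA.
rewrite A_S; apply: measurableD => //; apply: measurableU; first exact: mC.
by rewrite mp_image; apply: measurable_mp_preimage; exact: mC.
Qed.

Let A_A k : A_ k `<=` A.
Proof. by elim: k => // k IH; rewrite A_S => x [/IH]. Qed.

Let tA x : A x -> ~ A (t x).
Proof. by rewrite /A /= tt => h h'; have := lt_trans h h'; rewrite ltxx. Qed.

Let E_A k : E_ k `<=` A_ k.
Proof. by move=> x [[]//|[y [_ ? _ _] <-]]. Qed.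

(* The part of the space on which [t] is realized after k stages. *)
Let X_ k := [set x | (A x /\ ~ A_ k x) \/ (A (t x) /\ ~ A_ k (t x))].

Let mX_ k : measurable (X_ k).
Proof.
apply: measurableU; first by apply: measurableD.
by apply: (@measurable_mp_preimage _ _ _ _ t (A `\` A_ k)); exact: measurableD.
Qed.

(* After k stages [t] has been realized on the points used so far and their images;
   the next piece is disjoint from them, so that the pieces simply multiply. *)
Let used k : exists2 h, H h &
  (forall x, X_ k x -> h x = t x) /\ (forall x, ~ X_ k x -> h x = x).
Proof.
elim: k => [|k [h Hh [h1 h2]]].
  by exists 1%g => //; split => // x [[]|[]].
have gC x : C_ k x -> ~ C_ k (g_ k x).
  by move=> [_ _ _ nf] [_ _ lf _].
have CA : C_ k `<=` A by move=> x Cx; apply: (@A_A k); apply: E_A; left.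
have gCA x : C_ k x -> A (g_ k x).
  by move=> Cx; apply: (@A_A k); apply: E_A; right; exists x.
have [T1 [w [hT1 hw c1 c2]]] := @involution_piece_commutator _ _ _ _ _ mdist t (g_ k) A (C_ k)
  ht (g_L1 _) tt (mC (mA_ k)) tA CA gCA gC.
have XS x : X_ k.+1 x <-> X_ k x \/ (E_ k x \/ E_ k (t x)).
  rewrite /X_ /= -!/(E_ k); split.
    move=> [][Ax] /not_andP[nA|/contrapT Ex].
    - by left; left.
    - by right; left.
    - by left; right.
    - by right; right.
  move=> [[[Ax nA]|[Ax nA]]|[Ex|Ex]].
  - by left; split => // -[].
  - by right; split => // -[].
  - by left; split; [exact/(@A_A k)/E_A|move=> []].
  - by right; split; [exact/(@A_A k)/E_A|move=> []].
have XE x : E_ k x \/ E_ k (t x) -> ~ X_ k x.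
  move=> [/E_A Ex|/E_A Ex] [[Ax nA]|[Ax nA]] //.
    by apply: (@tA x) => //; exact: (@A_A k).
  by apply: (@tA x) => //; exact: (@A_A k).
exists (h * [~ T1, w])%g; first by apply: HM => //; exact: HR.
split=> x; rewrite mpME.
  move=> /XS[Xx|Ex].
    rewrite c2 ?h1// => Ex; apply: (XE x _ Xx); first by left.
    by right.
  rewrite c1// h2//; apply: XE; rewrite tt; case: Ex; [by right|by left].
move=> /XS/not_orP[nX /not_orP[nE nEt]].
by rewrite c2// h2.
Qed.

(* Two related points of the rest are separated by a rational level and linked by
   some [g i]; the stage examining this pair would have used them. *)
Let rest_null : mu.-negligible (\bigcap_k A_ k).
Proof.
apply: partial_transversal_null; first exact: bigcapT_measurable.
have key x y : (\bigcap_k A_ k) x -> (\bigcap_k A_ k) y -> graphing_rel Phi x y -> ~ f x < f y.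
  move=> Zx Zy /g_orbit[i yi] /rat_in_itvoo[q]; rewrite in_itv/= => /andP[xq qy].
  have [k ks] := stageP (i, q).
  have [_] : A_ k.+1 x by exact: Zx.
  apply; left; split; [exact: Zx|rewrite ks -yi; exact: Zy|by rewrite ks|].
  by rewrite ks -yi /= ltNge (ltW qy).
move=> x y Zx Zy xy; apply: finj; apply/eqP; rewrite eq_le !leNgt.
have yx : graphing_rel Phi y x.
  by move: xy => /graphing_rel_path[n /graphing_path_sym]; exact: graphing_path_rel.
by apply/andP; split; apply/negP; [exact: key yx|exact: key xy].
Qed.

Lemma greedy_approximation : mp_closure Phi H t.
Proof.
move=> e e0; pose u x := dist x (t x).
have [||||n hn] := @integral_decreasing_small _ _ _ mu u
    (measurable_mp_displacement mdist t) _ ht (fun k => ~` X_ k) e _ _ _ e0.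
- by move=> x; exact: graphing_dist_ge0.
- by move=> k; exact: measurableC.
- move=> k x nX Xx; apply: nX; case: Xx => -[Ax nA]; [left|right]; split => //.
    by rewrite A_S => -[].
  by rewrite A_S => -[].
- have : mu.-negligible ((\bigcap_k A_ k) `|` t @^-1` (\bigcap_k A_ k)).
    by apply: negligibleU => //; exact: mp_negligible.
  apply: negligibleS => x /= /not_implyP[nX ux].
  have tx : t x <> x by move=> tx; apply: ux; rewrite /u tx graphing_distxx.
  have : f (t x) != f x by apply/eqP => /finj.
  rewrite neq_lt => /orP[lt|lt].
    right => k _; apply: contrapT => nA; apply: (nX k); right; split => //.
    by rewrite /A /= tt.
  by left => k _; apply: contrapT => nA; apply: (nX k); left.
have [h Hh [h1 h2]] := used n; exists h => //.
have mX' : measurable (~` X_ n) by exact: measurableC.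
apply: le_lt_trans hn.
rewrite /mp_dist -(setUv (X_ n)) ge0_integral_setU//.
- rewrite [X in (X + _)%E]integral0_eq ?add0e; last first.
    by move=> x Xx; rewrite h1// graphing_distxx.
  apply: ge0_le_integral => //.
  + by move=> *; exact: graphing_dist_ge0.
  + by apply: measurable_funS measurableT _ (measurable_mp_dist mdist t h).
  + by apply: measurable_funS measurableT _ (measurable_mp_displacement mdist t).
  + by move=> x nX; rewrite h2// graphing_dist_sym.
- by rewrite setUv; exact: measurable_mp_dist.
- by move=> *; exact: graphing_dist_ge0.
- by apply/disj_setPS => x [].
Qed.

End greedy.

Lemma involution_in_closure t (H : set (mp_bij mu)) : mp_L1 Phi t -> (t * t = 1)%g ->
  H 1%g -> (forall S U, H S -> H U -> H (S * U)%g) ->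
  (forall S U, mp_L1 Phi S -> mp_L1 Phi U -> H [~ S, U]%g) -> mp_closure Phi H t.
Proof.
move=> ht tt H1 HM HR.
have [stage stageP] := countType_enum ((0%N, 0) : nat * rat).
apply: (greedy_approximation ht _ H1 HM HR stageP) => x.
by rewrite -mpME tt.
Qed.

End involutions.

(** * From bijections to the topological group *)

Section aut_quotient.
Context d (T : measurableType d) (R : realType) (mu : probability T R).
Implicit Types (S U : mp_bij mu) (s u : aut mu).

Definition aut_pi S : aut mu := (\pi_(aut mu) S)%qT.

Lemma aut_piM S U : aut_pi (S * U)%g = (aut_pi S * aut_pi U)%g.
Proof. exact: esym (aut_mul_pi S U). Qed.

Lemma aut_piV S : aut_pi S^-1%g = (aut_pi S)^-1%g.
Proof. exact: esym (aut_inv_pi S). Qed.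

Lemma aut_piR S U : aut_pi [~ S, U]%g = [~ aut_pi S, aut_pi U]%g.
Proof. by rewrite !commgEl !conjgE !aut_piM !aut_piV. Qed.

Lemma aut_piK s : aut_pi (repr s) = s. Proof. exact: reprK. Qed.

Lemma aut_piP S U : aut_pi S = aut_pi U <-> {ae mu, forall x, S x = U x}.
Proof.
split=> [/mp_eqP/asboolP|SU]; first by apply: filterS => x; apply.
by apply/mp_eqP/asboolP; apply: filterS SU => x.
Qed.

Lemma repr_aut_pi S : {ae mu, forall x, repr (aut_pi S) x = S x}.
Proof. by apply/aut_piP; exact: aut_piK. Qed.

End aut_quotient.

Section derived_subgroup.
Variables (G : groupType) (H : set G).
Local Open Scope group_scope.

Lemma derived_subgroup1 : derived_subgroup H 1.
Proof. by move=> K /= [[+ _] _]; rewrite inE. Qed.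

Lemma derived_subgroupF x y : derived_subgroup H x -> derived_subgroup H y ->
  derived_subgroup H (x * y^-1).
Proof.
move=> hx hy K /= /[dup] KH [[_ KF] _].
by have := KF x y; rewrite !inE; apply; [exact: hx|exact: hy].
Qed.

Lemma derived_subgroupV x : derived_subgroup H x -> derived_subgroup H x^-1.
Proof. by move=> hx; rewrite -[x^-1]mul1g; apply: derived_subgroupF => //; exact: derived_subgroup1. Qed.

Lemma derived_subgroupM x y : derived_subgroup H x -> derived_subgroup H y ->
  derived_subgroup H (x * y).
Proof.
by move=> hx hy; rewrite -[y]invgK; apply: derived_subgroupF => //; exact: derived_subgroupV.
Qed.

Lemma derived_subgroupR x y : H x -> H y -> derived_subgroup H [~ x, y].
Proof. by move=> Hx Hy K /= [_]; apply; exists x => //; exists y. Qed.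

Lemma derived_subgroup_min (K : set G) : K 1 ->
  (forall x y, K x -> K y -> K (x * y^-1)) ->
  (forall x y, H x -> H y -> K [~ x, y]) -> derived_subgroup H `<=` K.
Proof.
move=> K1 KF KR x; apply; split; last by move=> _ [a Ha [b Hb <-]]; exact: KR.
split; first by rewrite inE.
by move=> a b; rewrite !inE; exact: KF.
Qed.

End derived_subgroup.

Section topology.
Context d (T : measurableType d) (R : realType) (mu : probability T R).
Variable Phi : set (partial_iso mu).
Local Notation dist := (graphing_dist Phi).
Hypothesis mdist : forall g h : T -> T, measurable_fun setT g ->
  measurable_fun setT h -> measurable_fun setT (fun x => dist (g x) (h x)).
Hypothesis meq : forall g h : T -> T, measurable_fun setT g ->
  measurable_fun setT h -> measurable [set x | g x = h x].
Implicit Types (S U V : mp_bij mu) (s u : L1_full Phi).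

Lemma L1_distE (s u : aut mu) : L1_dist Phi s u = mp_dist Phi (repr s) (repr u).
Proof. by []. Qed.

Lemma L1_full_groupE (s : aut mu) : L1_full_group Phi s <-> mp_L1 Phi (repr s).
Proof.
split; first by case.
move=> h; split => //; rewrite /full_group /=.
have mw := measurable_mp_displacement mdist (repr s).
have iw : mu.-integrable setT (fun x => dist x (repr s x)).
  by apply/integrableP; split => //; under eq_integral do rewrite gee0_abs ?graphing_dist_ge0//.
have := integrable_ae measurableT iw; apply: filterS => x /(_ I).
by case: (graphing_dist_cases Phi x (repr s x)) => [[-> _]//|[n [_ /graphing_path_rel]]].
Qed.

Lemma mp_L1_ae S U : {ae mu, forall x, S x = U x} -> mp_L1 Phi U -> mp_L1 Phi S.
Proof.
move=> SU hU; apply: (mp_L1_near mdist hU).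
by rewrite mp_dist_sym (mp_dist_ae mdist SU).
Qed.

Lemma L1_full_group_pi S : mp_L1 Phi S -> L1_full_group Phi (aut_pi S).
Proof. by move=> hS; apply/L1_full_groupE; apply: mp_L1_ae hS; exact: repr_aut_pi. Qed.

Definition L1_of S (hS : mp_L1 Phi S) : L1_full Phi :=
  exist _ (aut_pi S) (mem_set (L1_full_group_pi hS)).

Lemma mp_dist_aeE S S' U U' : {ae mu, forall x, S x = S' x} -> {ae mu, forall x, U x = U' x} ->
  mp_dist Phi S U = mp_dist Phi S' U'.
Proof.
have le V V' (W W' : mp_bij mu) : {ae mu, forall x, V x = V' x} ->
    {ae mu, forall x, W x = W' x} ->
    (mp_dist Phi V W <= mp_dist Phi V' W')%E.
  move=> VV WW; apply: le_trans (mp_dist_triangle mdist V' _ _) _.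
  rewrite (mp_dist_ae mdist VV) add0e.
  apply: le_trans (mp_dist_triangle mdist W' _ _) _.
  by rewrite [X in (_ + X)%E]mp_dist_sym (mp_dist_ae mdist WW) adde0.
move=> SS UU; apply/eqP; rewrite eq_le; apply/andP; split; apply: le => //.
  by apply: filterS SS => x ->.
by apply: filterS UU => x ->.
Qed.

Lemma L1_nbhsP s (B : set (L1_full Phi)) :
  nbhs s B <-> exists2 e : R, 0 < e & L1_ball s e `<=` B.
Proof.
rewrite nbhsE; split=> [[B' [oB' B's] B'B]|[e e0 eB]].
  by have [e e0 eB'] := oB' s B's; exists e => //; exact: subset_trans B'B.
exists (L1_ball s e) => //; split; last first.
  by rewrite /L1_ball /= L1_distE mp_distxx lte_fin.
move=> u; rewrite /L1_ball /=; set D := L1_dist _ _ _ => De.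
have Dfin : D \is a fin_num.
  by rewrite ge0_fin_numE ?(lt_trans De) ?ltry//; exact: mp_dist_ge0.
exists (e - fine D); first by rewrite subr_gt0 -lte_fin fineK.
move=> v /=; rewrite EFinB fineK// => uv.
have := mp_dist_triangle mdist (repr (sval u)) (repr (sval s)) (repr (sval v)).
move=> /le_lt_trans; apply; rewrite -(L1_distE (sval s) (sval u)) -/D.
by move: uv; rewrite lteBrDl.
Qed.

Definition L1_image (K : set (mp_bij mu)) : set (L1_full Phi) :=
  [set s | exists2 U, K U & aut_pi U = sval s].

Lemma L1_full_L1 s : mp_L1 Phi (repr (sval s)).
Proof. by apply/L1_full_groupE; have := svalP s; rewrite inE. Qed.

(** A bijection close to an element of the L1 full group is itself integrable, so
    that approximation by bijections is approximation within the group. *)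
Lemma closure_L1_image K : closure (L1_image K) = [set s | mp_closure Phi K (repr (sval s))].
Proof.
apply/seteqP; split=> s /= hs.
  move=> e e0; have /hs[u [[U KU Uu] su]] : nbhs s (L1_ball s e) by apply/L1_nbhsP; exists e.
  exists U => //; apply: le_lt_trans su; rewrite L1_distE.
  rewrite (mp_dist_aeE (S' := repr (sval s)) (U' := repr (sval u)))//; first exact: aeW.
  by apply/aut_piP; rewrite aut_piK.
move=> B /L1_nbhsP[e /hs[U KU sU] eB].
have hU : mp_L1 Phi U.
  by apply: (mp_L1_near mdist (L1_full_L1 s)); apply: lt_trans sU _; rewrite ltry.
exists (L1_of hU); split; first by exists U.
apply: eB; rewrite /L1_ball /=; apply: le_lt_trans sU.
rewrite L1_distE.
rewrite (mp_dist_aeE (S' := repr (sval s)) (U' := U))//; first exact: aeW.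
exact: repr_aut_pi.
Qed.

Section connectedness.
Variable f : T -> R.
Hypotheses (mf : measurable_fun setT f) (finj : injective f).
Hypothesis fb : forall x, 0 <= f x <= 2.
Hypothesis nonat : nonatomic mu.

(** A level set of the injection is empty or a single point, which cannot be split. *)
Lemma level_null (r : R) : mu [set x | f x = r] = 0%E.
Proof.
have mL : measurable [set x | f x = r].
  by have := mf measurableT (measurable_set1 r); rewrite setTI.
apply/eqP; apply: contrapT => /negP; rewrite neq_lt ltNge measure_ge0/=.
move=> /(nonat mL)[B [mB BL B0 BL']].
have [[x Bx]|nB] := pselect (B !=set0); last first.
  move: B0; rewrite (_ : B = set0) ?measure0 ?ltxx//.
  by apply/seteqP; split => // x Bx; case: nB; exists x.
move: BL'; rewrite (_ : B = [set x | f x = r]) ?ltxx//.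
apply/seteqP; split => // y /= fy; rewrite (_ : y = x)//; apply: finj.
by rewrite fy (BL _ Bx).
Qed.

Section path.
Variables (U V : mp_bij mu).
Hypotheses (hU : mp_L1 Phi U) (hV : mp_L1 Phi V) (VV : (V * V = 1)%g).

Let m x := Order.min (f x) (f (V x)).

Let mm : measurable_fun setT m.
Proof.
apply: measurable_minr => //; apply: measurableT_comp => //; exact: measurable_mp.
Qed.

Let VVx x : V (V x) = x. Proof. by rewrite -mpME VV. Qed.

Let mV x : m (V x) = m x.
Proof. by rewrite /m VVx minC. Qed.

Let Y r := [set x | m x <= r].

Let mY r : measurable (Y r).
Proof.
rewrite (_ : Y r = m @^-1` `]-oo, r]%classic); last by apply/seteqP; split=> x /=; rewrite in_itv.
by rewrite -[X in measurable X]setTI; apply: mm.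
Qed.

Let VY r x : Y r (V x) <-> Y r x. Proof. by rewrite /Y /= mV. Qed.

Let V_ r := mp_restr (mY r) (@VY r).

Let V_in r x : m x <= r -> V_ r x = V x. Proof. by move=> h; exact: mp_restr_in. Qed.

Let V_out r x : r < m x -> V_ r x = x.
Proof. by move=> h; apply: mp_restr_out; rewrite /Y /= leNgt h. Qed.

Let V_cases r x : V_ r x = x \/ V_ r x = V x.
Proof. by case: (leP (m x) r) => h; [right; exact: V_in|left; exact: V_out]. Qed.

Let V_L1 r : mp_L1 Phi (V_ r).
Proof. exact: (mp_L1_restr mdist hV (V_cases r)). Qed.

Let V_V r : (V_ r * V_ r = 1)%g.
Proof.
apply: mp_bij_ext => x; rewrite mpME mp1E; case: (leP (m x) r) => h; last by rewrite !V_out.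
by rewrite (V_in h) V_in ?mV.
Qed.

Let gam r : L1_full Phi := L1_of (mp_L1M mdist hU (V_L1 r)).

Let V_dist (r e : R) : 0 < e -> exists2 dl : R, 0 < dl &
  forall q : R, `|r - q| < dl -> (mp_dist Phi (V_ r) (V_ q) < e%:E)%E.
Proof.
move=> e0; pose u x := dist x (V x).
have mu' : measurable_fun setT u by exact: measurable_mp_displacement.
pose F n := [set x | `|m x - r| <= n.+1%:R^-1].
have mF n : measurable (F n).
  have mg : measurable_fun setT (fun x => `|m x - r|).
    by apply: measurableT_comp => //; exact: measurable_funB.
  rewrite (_ : F n = (fun x => `|m x - r|) @^-1` `]-oo, n.+1%:R^-1]%classic).
    by rewrite -[X in measurable X]setTI; apply: mg.
  by apply/seteqP; split=> x /=; rewrite in_itv.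
have [|||n hn] := @integral_decreasing_small _ _ _ mu u mu' _ hV F e mF _ _ e0.
- by move=> x; exact: graphing_dist_ge0.
- move=> n x; rewrite /F /= => /le_trans; apply.
  by rewrite lef_pV2 ?posrE ?ltr0n// ler_nat.
- have : mu.-negligible ([set x | f x = r] `|` V @^-1` [set x | f x = r]).
    have h : mu.-negligible [set x | f x = r].
      apply/negligibleP; last exact: level_null.
      by have := mf measurableT (measurable_set1 r); rewrite setTI.
    by apply: negligibleU => //; exact: mp_negligible.
  apply: negligibleS => x /= /not_implyP[Fx _].
  have mxr : m x = r.
    apply/eqP; rewrite -subr_eq0 -normr_eq0; apply: contrapT => /negP.
    move=> nz; have pos : 0 < `|m x - r| by rewrite lt_neqAle eq_sym nz normr_ge0.
    have : `|m x - r| <= (Num.truncn `|m x - r|^-1).+1%:R^-1 by exact: Fx.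
    rewrite leNgt => /negP; apply.
    rewrite invf_plt ?posrE ?ltr0n//.
    exact: truncnS_gt.
  by move: mxr; rewrite /m; case: leP => _ ->; [left|right].
exists n.+1%:R^-1; first by rewrite invr_gt0 ltr0n.
move=> q rq; apply: le_lt_trans hn.
have mFC : measurable (~` F n) by exact: measurableC.
have off x : ~ F n x -> V_ r x = V_ q x.
  move=> /negP; rewrite -ltNge => h; move: rq h; set a := _^-1 => rq h.
  case: (leP (m x) r) => mr; case: (leP (m x) q) => mq.
  - by rewrite !V_in.
  - have := lt_trans rq h; rewrite ltNge distrC => /negP[].
    by rewrite !ger0_norm ?subr_ge0 ?(le_trans (ltW mq))// lerD2l lerN2 ltW.
  - have := lt_trans rq h; rewrite ltNge => /negP[].
    rewrite [leRHS]distrC !ger0_norm ?subr_ge0 ?lerD2r//; last exact: ltW.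
    exact: le_trans (ltW mr) mq.
  - by rewrite !V_out.
rewrite /mp_dist -(setUv (F n)) ge0_integral_setU//.
- rewrite [X in (_ + X)%E]integral0_eq ?adde0; last first.
    by move=> x /off ->; rewrite graphing_distxx.
  apply: ge0_le_integral => //.
  + by move=> *; exact: graphing_dist_ge0.
  + by apply: measurable_funS measurableT _ (measurable_mp_dist mdist (V_ r) (V_ q)).
  + by apply: measurable_funS measurableT _ mu'.
  + move=> x _; rewrite /u; case: (V_cases r x) => ->; case: (V_cases q x) => ->;
      rewrite ?graphing_distxx ?graphing_dist_ge0//.
    by rewrite graphing_dist_sym.
- by rewrite setUv; exact: measurable_mp_dist.
- by move=> *; exact: graphing_dist_ge0.
- by apply/disj_setPS => x [].
Qed.

Let gam_continuous : continuous gam.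
Proof.
move=> r B /L1_nbhsP[e e0 eB].
have [rho rho0 hrho] := mp_mull_continuous mdist meq hU e0.
have [dl dl0 hdl] := V_dist r rho0.
apply/nbhs_ballP; exists dl => // q; rewrite -ball_normE /= => rq.
apply: eB; rewrite /L1_ball /= L1_distE.
rewrite (mp_dist_aeE (S' := (U * V_ r)%g) (U' := (U * V_ q)%g)); try exact: repr_aut_pi.
by apply: hrho; exact: hdl.
Qed.

(** The restrictions of the involution [V] to the invariant sets [Y r] interpolate
    between the identity, for r below the range of [f], and [V], for r above it.
    They vary continuously because the level sets of [m] are null. *)
Lemma involution_path : exists C : set (L1_full Phi),
  [/\ connected C, exists2 s, C s & sval s = aut_pi U,
      exists2 s, C s & sval s = aut_pi (U * V)%g &
      forall s, C s -> exists2 W, (W * W = 1)%g /\ mp_L1 Phi W & sval s = aut_pi (U * W)%g].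
Proof.
exists (gam @` setT); split.
- apply: connected_continuous_connected.
    by apply/connected_intervalP => x y _ _ z.
  by apply: continuous_subspaceT; exact: gam_continuous.
- exists (gam (- 1)); first by exists (- 1).
  congr aut_pi; apply: mp_bij_ext => x; rewrite mpME V_out//.
  have /andP[h1 _] := fb x; have /andP[h2 _] := fb (V x).
  by rewrite lt_min; apply/andP; split; lra.
- exists (gam 2); first by exists 2.
  congr aut_pi; apply: mp_bij_ext => x; rewrite !mpME V_in//.
  by rewrite ge_min; have /andP[_ ->] := fb x.
- by move=> _ [r _ <-]; exists (V_ r).
Qed.

End path.

(** Following such paths one factor at a time joins every product of involutions to
    the identity inside the subgroup. *)
Lemma involutive_products_connected : connected (L1_image (involutive_product Phi)).
Proof.
pose one := L1_of (mp_L1_1 Phi).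
have joined U : involutive_product Phi U -> exists C : set (L1_full Phi),
    [/\ connected C, C one, (exists2 s, C s & sval s = aut_pi U) &
        C `<=` L1_image (involutive_product Phi)].
  elim=> [|S V hS [C [cC C1 [s Cs sS] CI]] hV VV].
    exists [set one]; split; [exact: connected1|by []|by exists one|].
    by move=> _ ->; exists 1%g => //; exact: Involutive_product1.
  have [C' [cC' [s' Cs' sS'] [u Cu uS] CI']] :=
    involution_path (involutive_product_L1 mdist hS) hV VV.
  exists (C `|` C'); split.
  - apply: connectedU => //; exists s; split => //.
    by rewrite (_ : s = s')//; apply: val_inj; rewrite /= sS sS'.
  - by left.
  - by exists u => //; right.
  - move=> v [/CI//|/CI'[W [WW hW] vW]].
    by exists (S * W)%g; [exact: Involutive_productM|].
have each (i : {U | involutive_product Phi U}) : exists C : set (L1_full Phi),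
    [/\ connected C, C one, (exists2 s, C s & sval s = aut_pi (sval i)) &
        C `<=` L1_image (involutive_product Phi)].
  by case: i => U hU; exact: joined.
have [C hC] := choice each.
rewrite (_ : L1_image _ = \bigcup_i C i).
  apply: bigcup_connected => [|i _]; last by have [] := hC i.
  by exists one => i _; have [] := hC i.
apply/seteqP; split=> [s [U hU Us]|s [i _ Cs]]; last first.
  by have [_ _ _ h] := hC i; exact: h.
exists (exist _ U hU) => //; have [_ _ [s' Cs' s'U] _] := hC (exist _ U hU).
by rewrite (_ : s = s')//; apply: val_inj; rewrite /= s'U -Us.
Qed.

End connectedness.
End topology.

Theorem corollary3p14 (R : realType) (d : measure_display)
    (X : measurableType d) (mu : probability X R)
    (X_standard : standard_borel R X) (mu_nonatomic : nonatomic mu)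
    (Phi : set (partial_iso mu)) (Phi_graphing : is_graphing Phi)
    (Phi_aperiodic : aperiodic Phi) :
  connected (closure (derived_L1_full Phi)).
Proof.
have [f [mf finj fb]] := standard_borel_real_coordinate X_standard.
have mdist := measurable_graphing_dist Phi_graphing mf finj.
have meq := measurable_eq_points mf finj.
have [g [g_bounded g_orbit]] := orbit_enumeration Phi_graphing mf finj.
pose G := L1_full_group Phi.
pose H : set (mp_bij mu) := [set S | derived_subgroup G (aut_pi S)].
pose E := involutive_product Phi.
have H1 : H 1%g by exact: derived_subgroup1.
have HM S U : H S -> H U -> H (S * U)%g.
  by rewrite /H /= aut_piM; exact: derived_subgroupM.
have HV S : H S -> H S^-1%g by rewrite /H /= aut_piV; exact: derived_subgroupV.
have HR S U : mp_L1 Phi S -> mp_L1 Phi U -> H [~ S, U]%g.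
  move=> hS hU; rewrite /H /= aut_piR.
  by apply: derived_subgroupR; exact: (L1_full_group_pi mdist).
have EL : E `<=` mp_L1 Phi by exact: involutive_product_L1.
have HE : H `<=` mp_closure Phi E.
  have : derived_subgroup G `<=` [set s | mp_closure Phi E (repr s)].
    apply: derived_subgroup_min.
    - apply: (mp_closure_ae mdist (U := 1%g)); first exact: (repr_aut_pi 1%g).
      by apply: sub_mp_closure; exact: Involutive_product1.
    - move=> s u hs hu; apply: (mp_closure_ae mdist (U := (repr s * (repr u)^-1)%g)).
        by apply/aut_piP; rewrite aut_piM aut_piV !aut_piK.
      apply: (mp_closureM mdist meq) => //; first exact: involutive_productMM.
      by apply: (mp_closureV mdist meq) => //; exact: involutive_productV.
    - move=> s u /(L1_full_groupE mdist) hs /(L1_full_groupE mdist) hu.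
      apply: (mp_closure_ae mdist (U := [~ repr s, repr u]%g)).
        by apply/aut_piP; rewrite aut_piR !aut_piK.
      exact: (commutator_in_closure mdist meq mf finj).
  move=> h S /h /= hS; apply: (mp_closure_ae mdist) hS.
  by apply: filterS (repr_aut_pi S) => x ->.
have HL : H `<=` mp_L1 Phi by move=> S /HE; exact: (mp_closure_L1 mdist EL).
have EH : E `<=` mp_closure Phi H.
  move=> S; elim=> [|U V _ IH hV VV]; first exact: sub_mp_closure.
  apply: (mp_closureM mdist meq) => //.
  exact: (involution_in_closure mdist meq Phi_aperiodic mf finj g_bounded g_orbit).
have -> : closure (derived_L1_full Phi) = closure (L1_image (Phi := Phi) E).
  have -> : derived_L1_full Phi = L1_image H.
    apply/seteqP; split=> s; first by move=> hs; exists (repr (sval s)); rewrite /H /= aut_piK.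
    by move=> [U hU Us]; rewrite /derived_L1_full /= -Us.
  rewrite !(closure_L1_image mdist); apply/seteqP; split=> s /= hs.
    by apply: (mp_closureK mdist); exact: mp_closureS hs.
  by apply: (mp_closureK mdist); exact: mp_closureS hs.
apply: connected_closure.
exact: (involutive_products_connected mdist meq mf finj fb mu_nonatomic).
Qed.
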